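(* Let $\Psi$ be an affine flow on $B\times H$ with linear part $\Phi$, lift $\Psi^1$ to $B\times H^1$, Selgrade bundles $\mathcal{V}_1,\dots,\mathcal{V}_\ell$ of $\Phi$, $\mathcal{V}_i^\infty=\mathcal{V}_i\times\{0\}$, central Selgrade bundle $\mathcal{V}_c^1$ of $\Psi^1$, and let $\ell^+,\ell^0$ be such that $\mathcal{V}_i^\infty\subset\mathcal{V}_c^1$ if and only if $i\in\{\ell^++1,\dots,\ell^++\ell^0\}$. (i) $\Sigma_{Mo}(\mathcal{V}_i;\Phi)\subset\Sigma_{Mo}(\mathcal{V}_c^1;\Psi^1)$ for every $i\in\{\ell^++1,\dots,\ell^++\ell^0\}$. (ii) If the flow $\Psi$ has a periodic trajectory, then $\mathcal{V}_c^1$ is the unique Selgrade bundle of $\Psi^1$ containing the lift $\Psi^1_t(b,x,1)$, $t\in\mathbb{R}$, of any periodic trajectory $\Psi_t(b,x)$ of $\Psi$, and $$\mathrm{co}\Big\{\{0\}\cup\bigcup_{i=\ell^++1}^{\ell^++\ell^0}\Sigma_{Mo}(\mathcal{V}_i;\Phi)\Big\}\subset\Sigma_{Mo}(\mathcal{V}_c^1;\Psi^1),$$ where $\mathrm{co}$ denotes the convex hull. (iii) For all $i\in\{1,\dots,\ell\}$, $$\Sigma_{Mo}(\mathcal{V}_i^\infty;\Psi^1)=\Sigma_{Mo}(\mathcal{V}_i;\Phi).$$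
   Context: Flows and chains: A flow on a metric space $X$ is a continuous map $\Phi:\mathbb{R}\times X\to X$ with $\Phi_0=\mathrm{id}$, $\Phi_{t+s}=\Phi_t\circ\Phi_s$. For $\varepsilon,T>0$ an $(\varepsilon,T)$-chain consists of $n\ge1$, $T_0,\dots,T_{n-1}\ge T$ and $x_0,x_1,\dots,x_n\in X$ with $d(\Phi_{T_i}(x_i),x_{i+1})<\varepsilon$ for $i=0,\dots,n-1$ (it goes from $x_0$ to $x_n$). A set $Y\subset X$ is chain transitive if for all $x,y\in Y$ and all $\varepsilon,T>0$ there is an $(\varepsilon,T)$-chain from $x$ to $y$. A chain recurrent component is a maximal chain transitive set. A trajectory through a point $y$ is periodic if $\Phi_\tau(y)=y$ for some $\tau>0$. Order: $\mathcal{M}\preceq\mathcal{M}'$ for chain recurrent components if there are components $\mathcal{M}=\mathcal{N}_0,\dots,\mathcal{N}_n=\mathcal{M}'$ and points $x_1,\dots,x_n$ with $\alpha(x_k)\subset\mathcal{N}_{k-1}$ and $\omega(x_k)\subset\mathcal{N}_k$ ($\alpha$- and $\omega$-limit sets). Linear flows and Selgrade's theorem: $B$ is a compact metric space with a chain transitive flow $\theta$ and $H$ is a real Hilbert space of finite dimension $d$. A linear flow on $B\times H$ is a flow $\Phi_t(b,x)=(\theta_tb,\varphi(t,b,x))$ with $\varphi(t,b,\cdot)$ linear. A subbundle is a closed subset of $B\times H$ intersecting each fiber in a linear subspace of constant dimension. $\mathbb{P}$ denotes the projections $H\setminus\{0\}\to\mathbb{P}H$ and $B\times(H\setminus\{0\})\to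 B\times\mathbb{P}H$ (for a subbundle $\mathcal{V}$, $\mathbb{P}\mathcal{V}$ is the image of its points with nonzero fiber component). $\mathbb{P}H$ has the metric $d(\mathbb{P}x,\mathbb{P}y)=\min\{\|\frac{x}{\|x\|}-\frac{y}{\|y\|}\|,\|\frac{x}{\|x\|}+\frac{y}{\|y\|}\|\}$, and $B\times\mathbb{P}H$ the maximum metric. $\Phi$ induces a flow $\mathbb{P}\Phi$ on $B\times\mathbb{P}H$. Selgrade's theorem: $\mathbb{P}\Phi$ has finitely many chain recurrent components, linearly ordered and numbered $\mathcal{M}_1\preceq\dots\preceq\mathcal{M}_\ell$; the sets $\mathcal{V}_i=\{(b,x)\mid x\ne0\Rightarrow(b,\mathbb{P}x)\in\mathcal{M}_i\}$ are subbundles, called the Selgrade bundles, and $B\times H=\mathcal{V}_1\oplus\dots\oplus\mathcal{V}_\ell$. Morse spectrum: For an $(\varepsilon,T)$-chain $\zeta$ of $\mathbb{P}\Phi$ given by $T_0,\dots,T_{n-1}\ge T$ and $(b_0,p_0),\dots,(b_n,p_n)$, with $\tau=\sum_{i=0}^{n-1}T_i$ and $\mathbb{P}x_i=p_i$, put $\lambda(\zeta)=\frac1\tau\sum_{i=0}^{n-1}\big(\log\|\varphi(T_i,b_i,x_i)\|-\log\|x_i\|\big)$. For an invariant subbundle $\mathcal{V}$, $\Sigma_{Mo}(\mathcal{V};\Phi)$ is the set of all $\lambda\in\mathbb{R}$ for which there are $\varepsilon^k\to0$, $T^k\to\infty$ and $(\varepsilon^k,T^k)$-chains $\zeta^k$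 of $\mathbb{P}\Phi$ in $\mathbb{P}\mathcal{V}$ (all points of the chain in $\mathbb{P}\mathcal{V}$) with $\lambda(\zeta^k)\to\lambda$. For a Selgrade bundle it is a compact interval. The same definitions are used for $\Psi^1$ on $B\times H^1$. Affine flows: An affine flow on $B\times H$ is a continuous map $\Psi=(\theta,\psi)$ for which there are a linear flow $\Phi=(\theta,\varphi)$ (the linear part) and $f:B\to L^\infty(\mathbb{R},H)$ with $f(b)(t+s)=f(\theta_sb)(t)$ for all $b$ and almost all $t,s$, and $\psi(t,b,x)=\varphi(t,b,x)+\int_0^t\varphi(t-s,\theta_sb,f(b)(s))\,ds$. Its lift is the linear flow on $B\times H^1$, $H^1=H\times\mathbb{R}$ (product Hilbert norm), given by $\Psi^1_t(b,x,r)=(\theta_tb,\varphi(t,b,x)+r\int_0^t\varphi(t-s,\theta_sb,f(b)(s))\,ds,r)$. There is a unique Selgrade bundle of $\Psi^1$ that intersects $B\times H\times(\mathbb{R}\setminus\{0\})$, called the central Selgrade bundle $\mathcal{V}_c^1$; the indices $i$ with $\mathcal{V}_i^\infty\subset\mathcal{V}_c^1$ form a (possibly empty) block $\{\ell^++1,\dots,\ell^++\ell^0\}$, and the remaining $\mathcal{V}_i^\infty$ are the other Selgrade bundles of $\Psi^1$. *)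

(* Defs.v *)
From HB Require Import structures.
From mathcomp Require Import all_boot all_order all_algebra.
From mathcomp Require Import sesquilinear.
From mathcomp Require Import all_classical all_reals all_analysis.
From mathcomp Require Import ess_sup_inf.
From mathcomp Require Import ring lra.

Set Implicit Arguments.
Unset Strict Implicit.
Unset Printing Implicit Defensive.

Import Order.TTheory GRing.Theory Num.Theory.
Import numFieldNormedType.Exports.

Local Open Scope classical_set_scope.
Local Open Scope ring_scope.

HB.mixin Record NormedVector_isHilbert (R : realType) H
    & NormedModule R H & Vector R H := {
  hdot : {dot H for (@idfun R)} ;
  hdot_norm : forall x : H, hdot x x = `|x| ^+ 2
}.

#[short(type="fdHilbertType")]
HB.structure Definition FdHilbert (R : realType) :=
  { H of NormedModule R H & Vector R H & NormedVector_isHilbert R H }.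

(* The library norms H * R^o by the maximum, hence the alias. *)
Definition lift_space (R : realType) (H : fdHilbertType R) : Type :=
  (H * R^o)%type.

Section lift_space.
Context {R : realType} {H : fdHilbertType R}.
Local Notation H1 := (lift_space H).

HB.instance Definition _ := Vector.copy H1 (H * R^o)%type.

Definition lift_dot (x y : H1) : R := hdot x.1 y.1 + x.2 * y.2.

Definition lift_norm (x : H1) : R := Num.sqrt (lift_dot x x).

Let lift_dotxx (x : H1) : lift_dot x x = `|x.1| ^+ 2 + x.2 ^+ 2.
Proof. by rewrite /lift_dot hdot_norm -expr2. Qed.

Let lift_dotxx_ge0 (x : H1) : 0 <= lift_dot x x.
Proof. by rewrite lift_dotxx addr_ge0// sqr_ge0. Qed.

Let lift_normD (x y : H1) : lift_norm (x + y) <= lift_norm x + lift_norm y.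
Proof.
rewrite -(@ler_pXn2r _ 2)// ?nnegrE ?addr_ge0 ?sqrtr_ge0//.
rewrite sqrrD !sqr_sqrtr// !lift_dotxx.
have h1 : `|x.1 + y.1| ^+ 2 <= (`|x.1| + `|y.1|) ^+ 2.
  by rewrite ler_pXn2r ?nnegrE ?addr_ge0// ler_normD.
have h2 : `|x.1| * `|y.1| + x.2 * y.2 <= lift_norm x * lift_norm y.
  rewrite -sqrtrM// (le_trans (ler_norm _))// -sqrtr_sqr ler_wsqrtr//.
  rewrite !lift_dotxx.
  rewrite -subr_ge0 (_ : _ - _ = (`|x.1| * y.2 - x.2 * `|y.1|) ^+ 2) ?sqr_ge0//.
  ring.
rewrite /= -!/(lift_norm _).
move: h1 h2; rewrite !sqrrD; lra.
Qed.

Let lift_normZ (l : R) (x : H1) : lift_norm (l *: x) = `|l| * lift_norm x.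
Proof.
rewrite -[`|l|]sqrtr_sqr -sqrtrM ?sqr_ge0// /lift_norm !lift_dotxx/=.
by rewrite normrZ exprMn real_normK ?num_real// exprMn mulrDr.
Qed.

Let lift_norm_eq0 (x : H1) : lift_norm x = 0 -> x = 0.
Proof.
move/eqP; rewrite sqrtr_eq0 lift_dotxx => x0.
have /eqP : `|x.1| ^+ 2 + x.2 ^+ 2 = 0.
  by apply/eqP; rewrite eq_le x0 addr_ge0// sqr_ge0.
rewrite paddr_eq0 ?sqr_ge0// !sqrf_eq0 normr_eq0 => /andP[/eqP h1 /eqP h2].
by case: x h1 h2 {x0} => /= ? ? -> ->.
Qed.

HB.instance Definition _ := Lmodule_isNormed.Build R H1
  lift_normD lift_normZ lift_norm_eq0.

Let lift_dot_bilinear : bilinear_for *%R (idfun \; *%R) lift_dot.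
Proof.
split=> z a x y; rewrite /lift_dot/=.
  rewrite linearDl linearZl_LR/= -[a *: x.2]/(a * x.2); ring.
rewrite linearDr linearZr_LR/= -[a *: x.2]/(a * x.2); ring.
Qed.

HB.instance Definition _ := bilinear_isBilinear.Build R H1 H1 R
  *%R (idfun \; *%R) lift_dot lift_dot_bilinear.

Let lift_dotC (x y : H1) : lift_dot x y = (-1) ^+ false * idfun (lift_dot y x).
Proof.
by rewrite /lift_dot expr0 mul1r/= hermC/= expr0 mul1r/= [x.2 * _]mulrC.
Qed.

HB.instance Definition _ := isHermitianSesquilinear.Build R H1 false idfun
  lift_dot lift_dotC.

Let lift_norm_dot (x : H1) : lift_dot x x = `|x| ^+ 2.
Proof. by rewrite /Num.norm/= sqr_sqrtr. Qed.

Let lift_dot_gt0 (x : H1) : x != 0 -> 0 < lift_dot x x.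
Proof. by move=> x0; rewrite lift_norm_dot exprn_gt0// normr_gt0. Qed.

HB.instance Definition _ := isDotProduct.Build R H1 lift_dot lift_dot_gt0.

HB.instance Definition _ := NormedVector_isHilbert.Build R H1 lift_norm_dot.

End lift_space.

Section product_metric.
Context {R : realType} {X Y : metricType R}.

Let prod_mdist (p q : X * Y) : R := Num.max (mdist p.1 q.1) (mdist p.2 q.2).

Let prod_mdist_ge0 p q : 0 <= prod_mdist p q.
Proof. by rewrite le_max mdist_ge0. Qed.

Let prod_mdist_positivity p q : prod_mdist p q = 0 -> p = q.
Proof.
case: p q => [x y] [x' y'] /eqP; rewrite eq_le => /andP[+ _].
rewrite ge_max/= => /andP[h1 h2]; congr (_, _); apply: mdist_positivity;
  by apply/eqP; rewrite eq_le ?h1 ?h2 mdist_ge0.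
Qed.

Let ballE p (d : R) : ball p d = [set q | prod_mdist p q < d].
Proof.
apply/seteqP; split=> q; rewrite /ball/= /prod_ball !ballEmdist/= gt_max.
  by move=> [-> ->].
by move/andP.
Qed.

HB.instance Definition _ := PseudoMetric_isMetric.Build R (X * Y)%type
  prod_mdist_ge0 prod_mdist_positivity ballE.

End product_metric.

Definition proj_space (R : realType) (H : fdHilbertType R) : Type :=
  {L : {vspace H} | \dim L == 1%N}.

Section proj_space.
Context {R : realType} {H : fdHilbertType R}.
Local Notation PH := (proj_space H).

HB.instance Definition _ :=
  SubChoice.copy PH {L : {vspace H} | \dim L == 1%N}.

Fact dim_proj_pt (x : H) : x != 0 -> \dim <[x]>%VS == 1%N.
Proof. by move=> x0; rewrite dim_vline x0. Qed.

Definition proj_pt (x : H) (x0 : x != 0) : PH :=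
  exist _ <[x]>%VS (dim_proj_pt x0).

Definition proj_repr (p : PH) : H := vpick (val p).

Let proj_unit (p : PH) : H := `|proj_repr p|^-1 *: proj_repr p.

Definition proj_dist (p q : PH) : R :=
  Num.min `|proj_unit p - proj_unit q| `|proj_unit p + proj_unit q|.

Lemma proj_repr_neq0 p : proj_repr p != 0.
Proof.
by case: p => L /= dL; rewrite /proj_repr/= vpick0 -dimv_eq0 (eqP dL).
Qed.

Lemma proj_reprK p : proj_pt (proj_repr_neq0 p) = p.
Proof.
apply/val_inj/eqP; rewrite /= eqEdim; apply/andP; split.
  by rewrite -memvE memv_pick.
by rewrite dim_vline proj_repr_neq0; case: p => L /= /eqP ->.
Qed.

Let proj_unit_pt (x : H) (x0 : x != 0) :
  proj_unit (proj_pt x0) = `|x|^-1 *: x \/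
  proj_unit (proj_pt x0) = - (`|x|^-1 *: x).
Proof.
have /vlineP[k kx] : proj_repr (proj_pt x0) \in <[x]>%VS by exact: memv_pick.
have k0 : k != 0.
  by apply: contraTneq (proj_repr_neq0 (proj_pt x0)) => k0;
     rewrite kx k0 scale0r eqxx.
rewrite /proj_unit kx normrZ invfM scalerA mulrAC.
have [kgt0|kle0] := ltrP 0 k; [left|right].
  by rewrite gtr0_norm// mulVf// mul1r.
have klt0 : k < 0 by rewrite lt_neqAle k0.
by rewrite ltr0_norm// invrN mulNr mulVf// mulN1r scaleNr.
Qed.

Lemma proj_distE (x y : H) (x0 : x != 0) (y0 : y != 0) :
  proj_dist (proj_pt x0) (proj_pt y0) =
  Num.min `| `|x|^-1 *: x - `|y|^-1 *: y| `| `|x|^-1 *: x + `|y|^-1 *: y|.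
Proof.
rewrite /proj_dist.
have [->|->] := proj_unit_pt x0; have [->|->] := proj_unit_pt y0 => //;
  move: (_ *: x) (_ *: y) => u v.
- by rewrite opprK minC.
- by rewrite -opprD normrN [- u + v]addrC distrC minC.
- by rewrite opprK -opprD normrN [- u + v]addrC distrC.
Qed.

Let proj_distxx p : proj_dist p p = 0.
Proof. by rewrite /proj_dist subrr normr0 min_l. Qed.

Let proj_dist_eq0 p q : proj_dist p q = 0 -> p = q.
Proof.
have unit_repr r : proj_repr r = `|proj_repr r| *: proj_unit r.
  by rewrite scalerA mulfV ?scale1r// normr_eq0 proj_repr_neq0.
have h k : k != 0 -> proj_repr p = k *: proj_repr q -> p = q.
  move=> k0 kpq; rewrite -[p]proj_reprK -[q]proj_reprK; apply: val_inj => /=.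
  apply/eqP; rewrite eqEdim !dim_vline !proj_repr_neq0 leqnn andbT -memvE.
  by rewrite kpq memvZ// memv_line.
have n0 r : `|proj_repr r| != 0 by rewrite normr_eq0 proj_repr_neq0.
rewrite /proj_dist; case: leP => _ /normr0_eq0 => [/subr0_eq pq|/eqP].
  apply: (h (`|proj_repr p| / `|proj_repr q|)); first by rewrite mulf_neq0 ?invr_eq0.
  by rewrite [LHS]unit_repr pq scalerA.
rewrite addr_eq0 => /eqP pq.
apply: (h (- (`|proj_repr p| / `|proj_repr q|))).
  by rewrite oppr_eq0 mulf_neq0 ?invr_eq0.
by rewrite [LHS]unit_repr pq scalerN scalerA scaleNr.
Qed.

Let proj_dist_sym p q : proj_dist p q = proj_dist q p.
Proof. by rewrite /proj_dist distrC [proj_unit p + _]addrC. Qed.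

Let proj_dist_triangle q p r : proj_dist p r <= proj_dist p q + proj_dist q r.
Proof.
rewrite /proj_dist; move: (proj_unit p) (proj_unit q) (proj_unit r) => u v w.
have h1 : `|u - w| <= `|u - v| + `|v - w| by rewrite ler_distD.
have h2 : `|u - w| <= `|u + v| + `|v + w|.
  by have := ler_distD (- v) u w; rewrite opprK -opprD normrN.
have h3 : `|u + w| <= `|u - v| + `|v + w|.
  by have := ler_distD v u (- w); rewrite !opprK.
have h4 : `|u + w| <= `|u + v| + `|v - w|.
  by have := ler_distD (- v) u (- w); rewrite !opprK [- v + w]addrC [`|w - v|]distrC.
rewrite ge_min; case: (leP `|u - v|) => _; case: (leP `|v - w|) => _;
  by rewrite ?h1 ?h2 ?h3 ?h4 ?orbT.
Qed.

HB.instance Definition _ := isMetric.Build R PH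
  proj_distxx proj_dist_eq0 proj_dist_sym proj_dist_triangle.

End proj_space.

Section dynamics.
Context {R : realType}.

Definition is_flow (X : topologicalType) (F : R -> X -> X) : Prop :=
  [/\ continuous (fun z : R * X => F z.1 z.2),
      forall x, F 0 x = x
    & forall t s x, F (t + s) x = F t (F s x)].

Definition periodic_point (X : Type) (F : R -> X -> X) (x : X) : Prop :=
  exists2 tau, 0 < tau & F tau x = x.

(* Only the values of chain_time below chain_size, and those of chain_pt up to
   and including chain_size, are relevant. *)
Record chain (X : Type) := Chain {
  chain_size : nat ;
  chain_time : nat -> R ;
  chain_pt : nat -> X
}.

Section metric.
Context {X : metricType R}.
Implicit Types (F : R -> X -> X) (Y M : set X).

Definition is_chain F (eps T : R) (z : chain X) : Prop :=
  (0 < chain_size z)%N /\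
  forall i, (i < chain_size z)%N ->
    T <= chain_time z i /\
    mdist (F (chain_time z i) (chain_pt z i)) (chain_pt z i.+1) < eps.

Definition chain_transitive F Y : Prop :=
  forall x y, Y x -> Y y -> forall eps T : R, 0 < eps -> 0 < T ->
  exists z : chain X, [/\ is_chain F eps T z, chain_pt z 0 = x
                        & chain_pt z (chain_size z) = y].

Definition chain_component F M : Prop :=
  chain_transitive F M /\
  forall Y, chain_transitive F Y -> M `<=` Y -> Y = M.

Definition omega_limit F (x : X) : set X := cluster (F t x @[t --> +oo]).

Definition alpha_limit F (x : X) : set X := cluster (F t x @[t --> -oo]).

Definition component_le F (M M' : set X) : Prop :=
  exists (n : nat) (N : nat -> set X) (x : nat -> X),
    [/\ N 0%N = M, N n = M',
        forall k, (k <= n)%N -> chain_component F (N k)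
      & forall k, (k < n)%N -> alpha_limit F (x k.+1) `<=` N k /\
                               omega_limit F (x k.+1) `<=` N k.+1].

End metric.
End dynamics.

Section linear_flows.
Context {R : realType} {B : metricType R} {H : fdHilbertType R}.
Local Notation PH := (proj_space H).
Implicit Types (theta : R -> B -> B) (phi psi : R -> B -> H -> H).
Implicit Types (V : set (B * H)) (M : set (B * PH)).

Definition skew_flow theta psi (t : R) (z : B * H) : B * H :=
  (theta t z.1, psi t z.1 z.2).

Definition linear_flow theta phi : Prop :=
  is_flow (skew_flow theta phi) /\ forall t b, linear (phi t b).

(* For a linear flow each phi t b is injective, so that the image of a line is a
   line and the default value of insubd is never taken; see proj_flowE. *)
Definition proj_flow theta phi (t : R) (z : B * PH) : B * PH :=
  (theta t z.1, insubd z.2 (linfun (phi t z.1) @: val z.2)%VS).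

Lemma linear_flow_neq0 theta phi t b (x : H) : linear_flow theta phi ->
  x != 0 -> phi t b x != 0.
Proof.
move=> [[_ F0 FD] lin]; apply: contra_neq => ptx.
have := F0 (b, x); rewrite -(addNr t) FD /skew_flow/= ptx => -[_ <-].
have := lin (- t) (theta t b) 1 0 0; rewrite !scale1r addr0 => /eqP.
by rewrite -subr_eq0 opprD addrA subrr sub0r oppr_eq0 => /eqP.
Qed.

Lemma proj_flowE theta phi t b (x : H) (x0 : x != 0)
    (ptx0 : phi t b x != 0) : linear_flow theta phi ->
  proj_flow theta phi t (b, proj_pt x0) = (theta t b, proj_pt ptx0).
Proof.
move=> [_ lin]; congr (_, _); apply: val_inj; rewrite /= limg_line.
pose g := GRing.isLinear.Build _ _ _ _ _ (lin t b).
pose h : {linear H -> H} := HB.pack (phi t b) g.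
have -> : linfun (phi t b) x = phi t b x by exact: (lfunE h x).
by rewrite val_insubd dim_vline ptx0.
Qed.

Definition proj_set V : set (B * PH) :=
  [set z | exists2 x0 : {x : H | x != 0}, V (z.1, val x0)
                                        & z.2 = proj_pt (valP x0)].

Definition bundle_of M : set (B * H) :=
  [set z | forall x0 : z.2 != 0, M (z.1, proj_pt x0)].

Definition selgrade_bundle theta phi V : Prop :=
  exists2 M, chain_component (proj_flow theta phi) M & V = bundle_of M.

(* The finite list of all chain recurrent components, increasing for the
   order of components; M i is the component numbered i.+1. *)
Definition component_numbering theta phi (l : nat) (M : 'I_l -> set (B * PH))
    : Prop :=
  [/\ injective M,
      forall N, chain_component (proj_flow theta phi) N <-> exists i, M i = N
    & forall i j : 'I_l, (i <= j)%N -> component_le (proj_flow theta phi) (M i) (M j)].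

Definition chain_total_time (z : chain (B * PH)) : R :=
  \sum_(i < chain_size z) chain_time z i.

(* Independent of the choice of representatives, each phi t b being linear. *)
Definition chain_exponent phi (z : chain (B * PH)) : R :=
  (chain_total_time z)^-1 *
  \sum_(i < chain_size z)
    (let x := proj_repr (chain_pt z i).2 in
     ln `|phi (chain_time z i) (chain_pt z i).1 x| - ln `|x|).

Definition morse_spectrum theta phi V : set R :=
  [set lambda | exists (eps T : nat -> R) (z : nat -> chain (B * PH)),
    [/\ eps @ \oo --> 0, T @ \oo --> +oo,
        forall k, [/\ 0 < eps k, 0 < T k,
          is_chain (proj_flow theta phi) (eps k) (T k) (z k)
        & forall i, (i <= chain_size (z k))%N -> proj_set V (chain_pt (z k) i)]
      & chain_exponent phi (z k) @[k --> \oo] --> lambda]].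

End linear_flows.

Section affine_flows.
Context {R : realType} {B : metricType R} {H : fdHilbertType R}.
Local Notation mu := (@lebesgue_measure R).
Implicit Types (theta : R -> B -> B) (phi psi : R -> B -> H -> H).
Implicit Types (f : B -> R -> H).

Definition oriented_integral (a b : R) (g : R -> R) : R :=
  if a <= b then \int[mu]_(s in `[a, b]) g s else - \int[mu]_(s in `[b, a]) g s.

(* Coordinatewise, hence independent of the basis. *)
Definition vector_integral (a b : R) (g : R -> H) : H :=
  \sum_(i < \dim {:H})
    oriented_integral a b (fun s => coord (vbasis {:H}) i (g s))
      *: (vbasis {:H})`_i.

Definition forcing theta phi f (t : R) (b : B) : H :=
  vector_integral 0 t (fun s => phi (t - s) (theta s b) (f b s)).

Definition in_Linfty (g : R -> H) : Prop :=
  measurable_fun [set: R] (g : R -> g_sigma_algebraType (@open H)) /\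
  (ess_sup mu (fun t => `|g t|%:E) < +oo)%E.

(* f b is a representative of an element of L^oo(R, H). *)
Definition affine_flow theta phi f psi : Prop :=
  [/\ linear_flow theta phi,
      forall b, in_Linfty (f b),
      forall b, {ae (mu \x mu)%E, forall z : R * R,
                   f b (z.1 + z.2) = f (theta z.2 b) z.1},
      forall t b x, psi t b x = phi t b x + forcing theta phi f t b
    & continuous (fun z : R * (B * H) => skew_flow theta psi z.1 z.2)].

Definition lift_cocycle theta phi f (t : R) (b : B) (z : lift_space H)
    : lift_space H :=
  (phi t b z.1 + z.2 *: forcing theta phi f t b, z.2).

Definition bundle_infty (V : set (B * H)) : set (B * lift_space H) :=
  [set z | V (z.1, z.2.1) /\ z.2.2 = 0].

Definition central_selgrade_bundle theta phi f (W : set (B * lift_space H))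
    : Prop :=
  unique (fun V => selgrade_bundle theta (lift_cocycle theta phi f) V /\
                   exists2 z, V z & z.2.2 != 0) W.

End affine_flows.

(* Smallest convex subset of R^o containing A. *)
Definition convex_hull (R : realType) (A : set R) : set R :=
  smallest (@convex_set R R^o) A.

(* Main.v *)
Require Import Defs.
From mathcomp Require Import all_boot all_order all_algebra.
From mathcomp Require Import all_classical all_reals all_analysis.
From mathcomp Require Import measurable_realfun ess_sup_inf.
From mathcomp Require Import ring lra.

(* For a component [M] of a flow on a compact metric space, pseudo-orbits
   joining two points of [M] with errors tending to 0 accumulate only on [M], so
   pushing them into [M] shows that [M] is internally chain transitive. Hence
   chains in [M] whose mean value is close to a point of the Morse spectrum can
   be closed up at a bounded cost in time, and running through two such loops
   with suitable multiplicities shows that the Morse spectrum of a Selgrade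
   bundle is convex. A periodic point of the affine flow lifts to a periodic
   point of the lift, hence to a chain recurrent point of its projectivization:
   its component defines the central bundle, and its orbit, run through many
   times as a single jump-free step, has exponent 0. Finally x |-> (x, 0)
   embeds the projectivized linear part isometrically into the projectivized
   lift, with the same exponents. That the lift is a flow comes down to a
   cocycle identity for the forcing term; the almost everywhere hypothesis on
   [f] gives it for almost every time, and continuity of [psi] for every time. *)

Set Implicit Arguments.
Unset Strict Implicit.
Unset Printing Implicit Defensive.

Import Order.TTheory GRing.Theory Num.Theory.
Import numFieldNormedType.Exports.

Local Open Scope classical_set_scope.
Local Open Scope ring_scope.

(** * Chains of flows on metric spaces *)

Lemma nbhs_mdistP (R : realType) (X : metricType R) (x : X) (A : set X) :
  nbhs x A <-> exists2 e : R, 0 < e & forall y, mdist x y < e -> A y.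
Proof.
split=> [/nbhs_ballP[e /= e0 eA]|[e e0 eA]].
  by exists e => // y xy; apply: eA; rewrite ballEmdist.
by apply/nbhs_ballP; exists e => //= y; rewrite ballEmdist => /eA.
Qed.

Lemma compact_cluster_seq (X : topologicalType) (u : nat -> X) :
  compact [set: X] -> exists p, cluster (u @ \oo) p.
Proof.
move=> cX; have [|p [_ up]] := cX (u @ \oo) _; last by exists p.
exact: filterT.
Qed.

(** Replaces the extraction of a convergent subsequence: an index with [u k] near the cluster point
    can moreover be asked to satisfy any eventual condition [P]. *)
Lemma cluster_seq_near (R : realType) (X : metricType R) (u : nat -> X) p :
  cluster (u @ \oo) p -> forall (e : R) (P : set nat), 0 < e ->
  (\forall k \near \oo, P k) -> exists2 k, P k & mdist p (u k) < e.
Proof.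
move=> up e P e0 nP.
have uP : (u @ \oo) (u @` P) by apply: filterS nP => k Pk; exists k.
have pe : nbhs p [set q | mdist p q < e] by apply/nbhs_mdistP; exists e.
by have [_ [[k Pk <-] /= ?]] := up _ _ uP pe; exists k.
Qed.

Lemma continuous_pair (S T U : topologicalType) (f : S -> T) (g : S -> U) :
  continuous f -> continuous g -> continuous (fun x => (f x, g x)).
Proof. by move=> cf cg x; exact: (cvg_pair (cf x) (cg x)). Qed.

Lemma fst_continuous (S T : topologicalType) : continuous (@fst S T).
Proof. by move=> x; exact: cvg_fst. Qed.

Lemma snd_continuous (S T : topologicalType) : continuous (@snd S T).
Proof. by move=> x; exact: cvg_snd. Qed.

Lemma flow_period (R : realType) (X : topologicalType) (F : R -> X -> X) tau x n :
  is_flow F -> F tau x = x -> F (tau *+ n) x = x.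
Proof.
case=> _ F0 FD xx; elim: n => [|n ih]; first by rewrite mulr0n F0.
by rewrite mulrSr FD xx.
Qed.

Lemma large_period (R : realType) (tau T : R) : 0 < tau -> exists n, T <= tau *+ n.
Proof.
move=> tau0; have /archi_boundP : 0 <= `|T| / tau by rewrite divr_ge0// ltW.
set n := Num.Def.archi_bound _ => Tn; exists n.
rewrite -mulr_natl -ler_pdivrMr// (le_trans _ (ltW Tn))//.
by rewrite ler_pM2r ?invr_gt0// ler_norm.
Qed.

Section weighted_chains.
Context {R : realType} {X : metricType R}.
Variables (F : R -> X -> X) (w : R -> X -> R).
Implicit Types (Y M : set X) (x y z : X) (eps T t tau s : R).

(* [tau] is the total time and [s] the sum of the weights of the steps, so that
   [s / tau] is the exponent of the chain. *)
Inductive wchain Y eps T : X -> X -> R -> R -> Prop :=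
| wchain1 x y t : Y x -> Y y -> T <= t -> mdist (F t x) y < eps ->
    wchain Y eps T x y t (w t x)
| wchainS x y z t tau s : Y x -> T <= t -> mdist (F t x) y < eps ->
    wchain Y eps T y z tau s -> wchain Y eps T x z (t + tau) (w t x + s).

Definition reach Y eps T x y := exists tau s, wchain Y eps T x y tau s.

Lemma wchain_cat Y eps T x y z tau s tau' s' :
  wchain Y eps T x y tau s -> wchain Y eps T y z tau' s' ->
  wchain Y eps T x z (tau + tau') (s + s').
Proof.
move=> h; elim: h z tau' s' => {x y tau s} [x y t Yx Yy Tt xy|
  x y z t tau s Yx Tt xy _ ih] q tau' s' h.
  exact: wchainS xy h.
by rewrite -!addrA; apply: wchainS xy (ih _ _ _ h).
Qed.

Lemma wchain_sub Y Y' eps eps' T T' x y tau s :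
  Y `<=` Y' -> eps <= eps' -> T' <= T ->
  wchain Y eps T x y tau s -> wchain Y' eps' T' x y tau s.
Proof.
move=> YY' ee' TT'; elim=> {x y tau s} [x y t Yx Yy Tt xy|
  x y z t tau s Yx Tt xy _ ih].
  apply: wchain1 (YY' _ Yx) (YY' _ Yy) (le_trans TT' Tt) _.
  exact: lt_le_trans ee'.
apply: wchainS (YY' _ Yx) (le_trans TT' Tt) _ ih.
exact: lt_le_trans ee'.
Qed.

Lemma wchain_endpoints Y eps T x y tau s :
  wchain Y eps T x y tau s -> Y x /\ Y y.
Proof. by elim=> {x y tau s} // x y z t tau s Yx _ _ _ [_ Yz]; split. Qed.

Lemma wchain_move_last Y eps T x y tau s e y' :
  wchain Y eps T x y tau s -> Y y' -> mdist y y' < e ->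
  wchain Y (eps + e) T x y' tau s.
Proof.
move=> h Yy'; elim: h => {x y tau s} [x y t Yx Yy Tt xy yy'|
  x y z t tau s Yx Tt xy _ ih zy'].
  apply: wchain1 => //; apply: le_lt_trans (metric_triangle _ y _) _.
  exact: ltrD.
apply: wchainS (ih zy') => //; rewrite (lt_le_trans xy)// lerDl.
exact/ltW/(le_lt_trans (mdist_ge0 _ _) zy').
Qed.

Lemma wchain_time_ge Y eps T x y tau s : 0 <= T ->
  wchain Y eps T x y tau s -> T <= tau.
Proof.
move=> T0; elim=> {x y tau s} // x y z t tau s Yx Tt _ _ Ttau.
by rewrite (le_trans Tt)// lerDl (le_trans T0).
Qed.

(** The inductive form suits concatenation and induction on the first step, while components and
    spectra are stated with the record [chain]; this is the passage between the two. *)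
Lemma wchainP Y eps T x y tau s : wchain Y eps T x y tau s <->
  exists z : chain X, [/\ is_chain F eps T z,
    forall i, (i <= chain_size z)%N -> Y (chain_pt z i),
    chain_pt z 0 = x /\ chain_pt z (chain_size z) = y,
    \sum_(i < chain_size z) chain_time z i = tau &
    \sum_(i < chain_size z) w (chain_time z i) (chain_pt z i) = s].
Proof.
split.
  elim=> {x y tau s} [x y t Yx Yy Tt xy|x y z t tau s Yx Tt xy _ [c]].
    exists (Chain 1 (fun=> t) (fun i => if i is 0%N then x else y)); split => /=.
    - by split => //= -[].
    - by case.
    - by [].
    - by rewrite big_ord1.
    - by rewrite big_ord1.
  case=> -[c0 ch] Yc [cx cz] <- <-.
  exists (Chain (chain_size c).+1
    (fun i => if i is j.+1 then chain_time c j else t)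
    (fun i => if i is j.+1 then chain_pt c j else x)); split => /=.
  - by split => //= -[_|i /ch//]; rewrite cx.
  - by case=> // i /Yc.
  - by [].
  - by rewrite big_ord_recl.
  - by rewrite big_ord_recl.
case=> -[n tm pt] [[/= n0 ch] Yc [/= <- <-] <- <-].
elim: n n0 tm pt ch Yc => // -[_ _|n ih _] tm pt ch Yc.
  have [? ?] := ch 0%N isT; rewrite !big_ord1.
  by apply: wchain1 => //; exact: Yc.
have [? ?] := ch 0%N isT; rewrite big_ord_recl [in X in wchain _ _ _ _ _ _ X]big_ord_recl.
apply: (@wchainS _ _ _ _ (pt 1%N)) => //; first exact: Yc.
apply: (ih isT (tm \o S) (pt \o S)).
- by move=> i; exact: (ch i.+1).
- by move=> i; exact: (Yc i.+1).
Qed.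

Lemma chain_transitive_reach M : chain_transitive F M <->
  forall x y eps T, M x -> M y -> 0 < eps -> 0 < T -> reach setT eps T x y.
Proof.
split=> h x y.
  move=> eps T Mx My e0 T0; have [z [cz zx zy]] := h x y Mx My eps T e0 T0.
  by do 2 eexists; apply/wchainP; exists z; split.
move=> Mx My eps T e0 T0; have [tau [s]] := h x y eps T Mx My e0 T0.
by move=> /wchainP[z [? _ [? ?] _ _]]; exists z.
Qed.

Lemma reach_cat Y eps T x y z :
  reach Y eps T x y -> reach Y eps T y z -> reach Y eps T x z.
Proof.
by move=> [tau [s h]] [tau' [s' h']]; do 2 eexists; exact: wchain_cat h h'.
Qed.

Lemma reach_sub Y Y' eps eps' T T' x y :
  Y `<=` Y' -> eps <= eps' -> T' <= T ->
  reach Y eps T x y -> reach Y' eps' T' x y.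
Proof.
by move=> ? ? ? [tau [s h]]; exists tau, s; exact: wchain_sub h.
Qed.

Lemma reach_move_last Y eps T x y e y' :
  reach Y eps T x y -> Y y' -> mdist y y' < e -> reach Y (eps + e) T x y'.
Proof.
by move=> [tau [s h]] ? ?; exists tau, s; exact: wchain_move_last h _ _.
Qed.

Hypothesis flowF : is_flow F.

(** No jump precedes the starting point to absorb its displacement. Instead [x'] flows for time [T],
    jumps to [F T x], and the first step of the given chain is resumed with its duration shortened
    by [T]; the bound [T + T] keeps what is left at least [T]. *)
Lemma reach_move_first eps T x x' y : 0 < T ->
  reach setT eps (T + T) x y -> mdist (F T x') (F T x) < eps ->
  reach setT eps T x' y.
Proof.
case: flowF => _ _ FD T0 [tau [s h]] xx'.
have e0 : 0 < eps by rewrite (le_lt_trans _ xx')// mdist_ge0.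
apply: (@reach_cat _ _ _ _ (F T x)).
  by do 2 eexists; exact: (@wchain1 _ _ _ _ _ T).
have FE t a : F (t - T) (F T a) = F t a by rewrite -FD subrK.
case: {s tau} h xx' => [a b t _ _ Tt ab|a b c t tau s _ Tt ab h] xx'.
  by do 2 eexists; apply: (@wchain1 _ _ _ _ _ (t - T)) => //;
    rewrite ?FE ?lerBrDr.
do 2 eexists; apply: (@wchainS _ _ _ _ b _ (t - T)) => //;
    rewrite ?FE ?lerBrDr//.
by apply: wchain_sub h => //; rewrite lerDl ltW.
Qed.

(** Adding multiples of the period lengthens a step at will without moving its end, so each point
    leads to the other by one step whose jump is zero. *)
Lemma periodic_reach Y tau x t eps T : 0 < tau -> F tau x = x -> 0 < eps ->
  Y x -> Y (F t x) -> reach Y eps T x (F t x) /\ reach Y eps T (F t x) x.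
Proof.
move=> tau0 xx eps0 Yx Yt; have [_ _ FD] := flowF; split.
  have [n Tn] := large_period (T - t) tau0; do 2 eexists.
  apply: (@wchain1 _ _ _ _ _ (t + tau *+ n)) => //; first by rewrite -lerBlDl.
  by rewrite FD flow_period// mdistxx.
have [n Tn] := large_period (T + t) tau0; do 2 eexists.
apply: (@wchain1 _ _ _ _ _ (tau *+ n - t)) => //; first by rewrite lerBrDr.
by rewrite -FD subrK flow_period// mdistxx.
Qed.

Lemma flow_continuous t : continuous (F t).
Proof.
case: flowF => cF _ _ x.
apply: (continuous_comp (f := fun y => (t, y))) (cF (t, x)).
by apply: continuous_pair => y; [exact: cst_continuous|exact: id].
Qed.

Lemma flow_continuous_mdist t x e : 0 < e ->
  exists2 d, 0 < d & forall y, mdist x y < d -> mdist (F t x) (F t y) < e.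
Proof.
move=> e0; apply/nbhs_mdistP.
have : nbhs (F t x) [set y | mdist (F t x) y < e] by apply/nbhs_mdistP; exists e.
exact: flow_continuous.
Qed.

(** Maximality: [M] with [y] adjoined is still chain transitive, every chain being routed through
    [x]. *)
Lemma chain_component_equiv M x y : chain_component F M -> M x ->
  (forall eps T, 0 < eps -> 0 < T -> reach setT eps T x y) ->
  (forall eps T, 0 < eps -> 0 < T -> reach setT eps T y x) -> M y.
Proof.
case=> /chain_transitive_reach trM maxM Mx xy yx.
rewrite -(maxM (M `|` [set y])); [by right| |by left].
apply/chain_transitive_reach => a b eps T Ma Mb e0 T0.
apply: (@reach_cat _ _ _ _ x).
  by case: Ma => [Ma|->]; [exact: trM|exact: yx].
by case: Mb => [Mb|->]; [exact: trM|exact: xy].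
Qed.

(** The component is the class of all points joined to and from [x] by chains; any chain transitive
    set containing this class contains [x], hence lies in it. *)
Lemma chain_component_exists x :
  (forall eps T, 0 < eps -> 0 < T -> reach setT eps T x x) ->
  exists2 M, chain_component F M & M x.
Proof.
move=> xx.
pose M := [set y | forall eps T, 0 < eps -> 0 < T ->
             reach setT eps T x y /\ reach setT eps T y x].
exists M; last by move=> eps T e0 T0; split; exact: xx.
split.
  apply/chain_transitive_reach => a b eps T Ma Mb e0 T0.
  have [_ ax] := Ma _ _ e0 T0; have [xb _] := Mb _ _ e0 T0.
  exact: reach_cat ax xb.
move=> Y /chain_transitive_reach trY MY; apply/seteqP; split=> // y Yy eps T e0 T0.
have Yx : Y x by apply: MY => ? ? ? ?; split; exact: xx.
by split; exact: trY.
Qed.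

(** A limit point [p] of [M] is chain equivalent to a point of [M]: arriving at [p] costs a slightly
    larger last jump, and leaving from [p] uses continuity of the time-[T] map. *)
Lemma chain_component_closed M : chain_component F M -> closed M.
Proof.
move=> cM p clp.
have [[trM _] near_p] : chain_component F M /\
    forall e : R, 0 < e -> exists2 x, M x & mdist p x < e.
  split=> // e e0.
  have pe : nbhs p [set q | mdist p q < e] by apply/nbhs_mdistP; exists e.
  by have [x [Mx /= ?]] := clp _ pe; exists x.
have {}trM := (chain_transitive_reach M).1 trM.
have [x Mx _] := near_p 1 ltr01.
apply: (chain_component_equiv cM Mx) => eps T e0 T0.
  have e20 : 0 < eps / 2 by rewrite divr_gt0.
  have [y My py] := near_p _ e20.
  rewrite (splitr eps); apply: (@reach_move_last _ _ _ _ y) => //.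
    exact: trM.
  by rewrite metric_sym.
have [d d0 hd] := flow_continuous_mdist T p e0.
have [y My py] := near_p _ d0.
apply: (@reach_move_first _ _ y) => //; last exact: hd.
by apply: trM => //; rewrite addr_gt0.
Qed.

Hypothesis compactX : compact [set: X].

(** Joint continuity at each point of the compact product of [[0, K]] and [X] gives a local radius,
    and the covering form of compactness makes it uniform. *)
Lemma flow_unif_continuous (K e : R) : 0 < e -> exists2 d, 0 < d &
  forall t x y, 0 <= t <= K -> mdist x y < d -> mdist (F t x) (F t y) < e.
Proof.
move=> e0; have cK : compact (`[0, K]%classic `*` [set: X]).
  by apply: compact_setX => //; exact: segment_compact.
have nr : \forall d \near 0^'+, `[0, K]%classic `*` [set: X] `<=`
    fun p => forall y, mdist p.2 y < d -> mdist (F p.1 p.2) (F p.1 y) < e.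
  apply: ((compact_near_coveringP _).1 cK) => -[t x] _ /=.
  have [cF _ _] := flowF.
  have e20 : 0 < e / 2 by rewrite divr_gt0.
  have : nbhs (F t x) [set y | mdist (F t x) y < e / 2] by apply/nbhs_mdistP; exists (e / 2).
  move/(cF (t, x)) => [[A B] [/= nA /nbhs_mdistP[d d0 dB]] AB].
  (* Halving [d] leaves room for both the displacement of the centre [x'] and the distance from [x']
     to [y]. *)
  have d20 : 0 < d / 2 by rewrite divr_gt0.
  exists ((A `*` [set y | mdist x y < d / 2]), [set r | r < d / 2]).
    split => /=; last exact: nbhs_right_lt.
    by exists (A, [set y | mdist x y < d / 2]) => //; split => //=;
      apply/nbhs_mdistP; exists (d / 2).
  move=> [[t' x'] r] [/= [At' xx'] rd] y x'y.
  have h1 : mdist (F t x) (F t' x') < e / 2.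
    apply: (AB (t', x')); split => //=; apply: dB.
    by rewrite (lt_le_trans xx')// ler_pdivrMr// ler_peMr ?ltW// ltr1n.
  have h2 : mdist (F t x) (F t' y) < e / 2.
    apply: (AB (t', y)); split => //=; apply: dB.
    apply: le_lt_trans (metric_triangle _ x' _) _; rewrite (splitr d) ltrD//.
    exact: lt_trans rd.
  apply: le_lt_trans (metric_triangle _ (F t x) _) _.
  by rewrite (splitr e) ltrD// metric_sym.
have [d /= [hd d0]] := @filter_ex _ (0^'+) _ _ (filterI nr (nbhs_right_gt 0)).
exists d => // t x y tK xy.
by apply: (hd (t, x)).
Qed.

End weighted_chains.

(** * Internal chain transitivity of chain recurrent components *)

Section internal_chain_transitivity.
Context {R : realType} {X : metricType R}.
Variables (F : R -> X -> X) (w : R -> X -> R).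
Hypotheses (flowF : is_flow F) (compactX : compact [set: X]).
Implicit Types (Y M : set X) (x y z : X) (d e eps T t : R).

Local Notation reach := (reach F w).

(** Pseudo-orbits with a counted number of steps, each of duration in [[T, 2T]]: the upper bound
    makes uniform continuity on a bounded time interval available, which arbitrarily long steps do
    not allow. *)
Fixpoint bounded_steps d T n x y : Prop :=
  if n is n'.+1 then exists t z,
    [/\ T <= t <= T + T, mdist (F t x) z < d & bounded_steps d T n' z y]
  else x = y.

Lemma bounded_steps_cat d T m n x y z :
  bounded_steps d T m x y -> bounded_steps d T n y z ->
  bounded_steps d T (m + n) x z.
Proof.
elim: m x => [x ->//|m ih x [t [a [? ? h]]] h']; exists t, a; split=> //.
exact: ih h h'.
Qed.

Lemma bounded_steps_split d T m n x z : bounded_steps d T (m + n) x z ->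
  exists2 y, bounded_steps d T m x y & bounded_steps d T n y z.
Proof.
elim: m x => [x ?|m ih x [t [a [? ? /ih[y ? ?]]]]]; first by exists x.
by exists y => //; exists t, a.
Qed.

Lemma bounded_steps_loop d T m n x :
  bounded_steps d T m x x -> bounded_steps d T (n * m) x x.
Proof. by move=> h; elim: n => // n; exact: bounded_steps_cat. Qed.

Lemma bounded_steps_le d d' T n x y : d <= d' ->
  bounded_steps d T n x y -> bounded_steps d' T n x y.
Proof.
move=> dd'; elim: n x => // n ih x [t [z [tT xz h]]]; exists t, z; split=> //.
  exact: lt_le_trans dd'.
exact: ih.
Qed.

(** At least one step is required, since the error is absorbed by the last jump. *)
Lemma bounded_steps_move_last d e T n x y y' :
  bounded_steps d T n.+1 x y -> mdist y y' < e ->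
  bounded_steps (d + e) T n.+1 x y'.
Proof.
move=> + yy'; have e0 : 0 <= e := ltW (le_lt_trans (mdist_ge0 y y') yy').
elim: n x => [x [t [z [tT xz /= zy]]]|n ih x [t [z [tT xz h]]]].
  exists t, y'; split=> //; apply: le_lt_trans (metric_triangle _ z _) _.
  by rewrite ltrD// zy.
exists t, z; split=> //; first by rewrite (lt_le_trans xz)// lerDl.
exact: ih.
Qed.

Lemma bounded_steps_move_first d e T n x x' y :
  bounded_steps d T n.+1 x y ->
  (forall t, T <= t <= T + T -> mdist (F t x') (F t x) < e) ->
  bounded_steps (d + e) T n.+1 x' y.
Proof.
move=> [t [z [tT xz h]]] x'x; have x'xt := x'x t tT; exists t, z; split=> //.
  apply: le_lt_trans (metric_triangle _ (F t x) _) _.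
  by rewrite addrC ltrD.
apply: bounded_steps_le h.
by rewrite lerDl; exact: ltW (le_lt_trans (mdist_ge0 _ _) x'xt).
Qed.

(** A long step is cut into jump-free pieces of duration [T] until the remainder is at most [2T];
    only the last piece carries the jump. *)
Lemma bounded_steps_of_step d T t x y : 0 < d -> 0 < T -> T <= t ->
  mdist (F t x) y < d -> exists n, bounded_steps d T n.+1 x y.
Proof.
move=> d0 T0; have [_ _ FD] := flowF.
have [N tN] : exists N, t <= T * N.+1%:R.
  have /archi_boundP : 0 <= `|t| / T by rewrite divr_ge0// ltW.
  set N := Num.Def.archi_bound _ => tN; exists N.
  apply: (@le_trans _ _ (T * N%:R)); last by rewrite ler_pM2l// ler_nat.
  by rewrite mulrC -ler_pdivrMr// (le_trans _ (ltW tN))// ler_pM2r ?invr_gt0// ler_norm.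
elim: N t x tN => [|N ih] t x tN Tt xy.
  exists 0%N, t, y; split=> //; rewrite Tt (le_trans tN)// mulr1.
  by rewrite lerDl ltW.
have [tTT|TTt] := leP t (T + T); first by exists 0%N, t, y; split=> //; rewrite Tt.
have [|||n h] := ih (t - T) (F T x).
- by rewrite lerBlDr (le_trans tN)// -[in leLHS]addn1 natrD mulrDr mulr1.
- by rewrite lerBrDr ltW.
- by rewrite -FD subrK.
exists n.+1, T, (F T x); split=> //; last by rewrite mdistxx.
by rewrite lexx lerDl ltW.
Qed.

Lemma reach_bounded_steps d T x y : 0 < d -> 0 < T ->
  reach setT d T x y -> exists n, bounded_steps d T n.+1 x y.
Proof.
move=> d0 T0 [tau [s]]; elim=> {x y tau s} [x y t _ _ Tt xy|
  x y z t tau s _ Tt xy _ [n yz]]; first exact: bounded_steps_of_step xy.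
have [m {}xy] := bounded_steps_of_step d0 T0 Tt xy.
by exists (m + n.+1)%N; exact: bounded_steps_cat xy yz.
Qed.

(** The true orbit of [x] shadows a pseudo-orbit of at most [N] steps: the total time is at most
    [2TN], so for [d] small enough each jump grows to at most [e] by the end, and these errors add
    up. *)
Lemma bounded_steps_merge N e T : 0 < e -> 0 < T ->
  exists2 d, 0 < d & forall n x y, (n <= N)%N -> bounded_steps d T n x y ->
  exists2 t, T * n%:R <= t <= (T + T) * n%:R & mdist (F t x) y <= e * n%:R.
Proof.
move=> e0 T0; have [_ F0 FD] := flowF.
have [d d0 hd] := flow_unif_continuous flowF compactX ((T + T) * N%:R) e0.
exists d => //; elim=> [x _ _ <-|n ih x y nN [t [z [/andP[tT tTT] xz zy]]]].
  by exists 0; rewrite ?mulr0 ?F0 ?mdistxx ?lexx.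
have [t' /andP[t'T t'TT] zt'y] := ih _ _ (ltnW nN) zy.
exists (t' + t).
  by rewrite -addn1 natrD !mulrDr !mulr1 !lerD.
rewrite FD -addn1 natrD mulrDr mulr1.
apply: le_trans (metric_triangle _ (F t' z) _) _; rewrite addrC lerD//.
apply/ltW/hd => //; apply/andP; split.
  by apply: le_trans t'T; rewrite mulr_ge0// ltW.
by apply: le_trans t'TT _; rewrite ler_pM2l ?addr_gt0// ler_nat ltnW.
Qed.

(** A pseudo-orbit of at least [N] steps is cut into blocks of [N] to [2N] steps, and each block is
    merged into a single step of duration at least [T * N]. *)
Lemma bounded_steps_group N eps T : (0 < N)%N -> 0 < eps -> 0 < T ->
  exists2 d, 0 < d & forall n x y, (N <= n)%N -> bounded_steps d T n x y ->
  reach setT eps (T * N%:R) x y.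
Proof.
move=> N0 eps0 T0.
(* The denominator exceeds the largest block size [2N], so that the accumulated error of a block
   stays below [eps]. *)
have e0 : 0 < eps / (N + N).+1%:R by rewrite divr_gt0.
have [d d0 hd] := bounded_steps_merge (N + N) e0 T0; exists d => // n.
have merged m x y : (N <= m <= N + N)%N -> bounded_steps d T m x y ->
    reach setT eps (T * N%:R) x y.
  move=> /andP[Nm mN] /(hd _ _ _ mN)[t /andP[mt _] xy].
  do 2 eexists; apply: (@wchain1 _ _ _ _ _ _ _ _ _ t) => //.
    by rewrite (le_trans _ mt)// ler_pM2l// ler_nat.
  rewrite (le_lt_trans xy)// mulrAC ltr_pdivrMr// ltr_pM2l// ltr_nat.
  by rewrite ltnS.
elim/ltn_ind: n => n ih x y Nn h.
have [nN|Nn2] := leqP n (N + N); first by apply: merged h; rewrite Nn.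
move: h; rewrite -(subnKC Nn) => /bounded_steps_split[z xz zy].
apply: (@reach_cat _ _ _ _ _ _ _ _ z).
  by apply: merged xz; rewrite leqnn leq_addr.
by apply: ih zy; rewrite ?ltn_subrL ?N0 ?(leq_trans N0 Nn)// leq_subRL// ltnW.
Qed.

(* Arbitrarily long pseudo-orbits with steps of bounded duration give chains
   for every [T'], since consecutive steps can be merged. *)
Lemma reach_of_long_bounded_steps T x y : 0 < T ->
  (forall d N, 0 < d -> exists2 n, (N <= n)%N & bounded_steps d T n x y) ->
  forall eps T', 0 < eps -> reach setT eps T' x y.
Proof.
move=> T0 h eps T' eps0.
have /archi_boundP : 0 <= `|T'| / T by rewrite divr_ge0// ltW.
set N := Num.Def.archi_bound _ => tN.
have [//|d d0 hd] := @bounded_steps_group N.+1 eps T _ eps0 T0.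
have [n Nn xy] := h d N.+1 d0.
apply: reach_sub (hd _ _ _ Nn xy) => //.
apply: (@le_trans _ _ (T * N%:R)); last by rewrite ler_pM2l// ler_nat.
by rewrite mulrC -ler_pdivrMr// (le_trans _ (ltW tN))// ler_pM2r ?invr_gt0// ler_norm.
Qed.

(** Otherwise, for jumps tending to 0, there are pseudo-orbits from [x] to [y] through points [u k]
    at distance at least [e] from [M]. A cluster point [p] of [u] is reached from [x] and leads to
    [y], so it belongs to [M], a contradiction. *)
Lemma bounded_steps_near_component M x y e T :
  chain_component F M -> M x -> M y -> 0 < e -> 0 < T ->
  exists2 d, 0 < d & forall m n z, bounded_steps d T m x z ->
    bounded_steps d T n z y -> exists2 q, M q & mdist z q < e.
Proof.
move=> cM Mx My e0 T0; apply: contrapT => nh.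
have trM := (chain_transitive_reach F w M).1 cM.1.
(* Loops at [x] and at [y] serve to raise the number of steps beyond any bound. *)
have loop q d N : M q -> 0 < d ->
    exists2 n, (N <= n)%N & bounded_steps d T n q q.
  move=> Mq d0; have [n h] := reach_bounded_steps d0 T0 (trM _ _ _ _ Mq Mq d0 T0).
  exists (N * n.+1)%N; last exact: bounded_steps_loop.
  by rewrite leq_pmulr.
have bad k : exists z, (exists m n, bounded_steps k.+1%:R^-1 T m x z /\
    bounded_steps k.+1%:R^-1 T n z y) /\ forall q, M q -> e <= mdist z q.
  apply: contrapT => nz; apply: nh; exists k.+1%:R^-1 => // m n z h1 h2.
  apply: contrapT => nq; apply: nz; exists z; split; first by exists m, n.
  by move=> q Mq; rewrite leNgt; apply/negP => zq; apply: nq; exists q.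
have [u hu] := choice bad.
have [p up] := compact_cluster_seq u compactX.
have ux k : e <= mdist (u k) x := (hu k).2 x Mx.
have uy k : e <= mdist (u k) y := (hu k).2 y My.
have small d : 0 < d -> \forall k \near \oo, k.+1%:R^-1 < d :> R.
  by move=> d0; exact: near_infty_natSinv_lt (PosNum d0).
suff Mp : M p.
  have [k _] := cluster_seq_near up e0 (filterT : \forall k \near \oo, setT k).
  by rewrite metric_sym ltNge (hu k).2.
apply: (chain_component_equiv (w := w) cM Mx).
  move=> eps T' eps0 _; apply: (reach_of_long_bounded_steps T0) => // d N d0.
  have [n Nn xx] := loop x d N Mx d0.
  have d20 : 0 < d / 2 by rewrite divr_gt0.
  have [k kd pk] := cluster_seq_near up d20 (small _ d20).
  have [[m [_ [xu _]]] _] := hu k.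
  (* With no step, [u k] would be [x] itself, a point of [M]; so there is a last jump to adjust. *)
  case: m xu => [xu|m xu].
    by have := ux k; rewrite -xu mdistxx leNgt e0.
  exists (n + m.+1)%N; first by rewrite (leq_trans Nn)// leq_addr.
  apply: bounded_steps_cat xx _; rewrite (splitr d).
  apply: bounded_steps_move_last; last by rewrite metric_sym; exact: pk.
  exact: bounded_steps_le (ltW kd) xu.
(* From [p] one goes to [y] first, and from [y] back to [x] by chain transitivity. *)
move=> eps T' eps0 T'0; apply: (@reach_cat _ _ _ _ _ _ _ _ y); last exact: trM.
apply: (reach_of_long_bounded_steps T0) => // d N d0.
have [n Nn yy] := loop y d N My d0.
have d20 : 0 < d / 2 by rewrite divr_gt0.
have [r r0 hr] := flow_unif_continuous flowF compactX (T + T) d20.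
have [k kd pk] := cluster_seq_near up r0 (small _ d20).
have [[_ [m [_ uy']]] _] := hu k.
case: m uy' => [uy'|m uy'].
  by have := uy k; rewrite uy' mdistxx leNgt e0.
exists (m.+1 + n)%N; first by rewrite (leq_trans Nn)// leq_addl.
apply: bounded_steps_cat yy; rewrite (splitr d).
apply: (@bounded_steps_move_first _ _ _ _ (u k)).
  exact: bounded_steps_le (ltW kd) uy'.
move=> t /andP[Tt tT]; apply: hr => //.
by rewrite tT andbT (le_trans (ltW T0)).
Qed.

(** The points of a fine enough pseudo-orbit from [x] to [y] lie near [M] and are replaced by nearby
    points of [M]. A new jump consists of three errors, each below [eps / 3]: the flow of the
    displacement, the old jump, and the displacement of the next point. *)
Lemma chain_component_reach M x y eps T :
  chain_component F M -> M x -> M y -> 0 < eps -> 0 < T ->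
  reach M eps T x y.
Proof.
move=> cM Mx My eps0 T0.
have e0 : 0 < eps / 3 by rewrite divr_gt0.
have [r r0 hr] := flow_unif_continuous flowF compactX (T + T) e0.
have re0 : 0 < Num.min r (eps / 3) by rewrite lt_min r0.
have [d d0 hd] := bounded_steps_near_component cM Mx My re0 T0.
pose d' := Num.min d (eps / 3); have d'0 : 0 < d' by rewrite lt_min d0.
have [n xy] : exists n, bounded_steps d' T n.+1 x y.
  apply: reach_bounded_steps => //.
  exact: ((chain_transitive_reach F w M).1 cM.1).
have d'd : d' <= d by rewrite ge_min lexx.
have {}hr t a b : T <= t <= T + T -> mdist a b < r -> mdist (F t a) (F t b) < eps / 3.
  by move=> /andP[Tt tT]; apply: hr; rewrite tT (le_trans (ltW T0)).
(* The induction carries the past steps from [x] to [z], because closeness to [M] is known only for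
   points lying on a pseudo-orbit from [x] to [y]. *)
suff h m z q : bounded_steps d' T n.+1 z y -> bounded_steps d' T m x z -> M q ->
    mdist q z < r -> reach M eps T q y.
  by apply: (h 0%N x x) => //; rewrite mdistxx.
elim: n {xy} m z q => [|n ih] m z q [t [z' [tT zz' h]]] xz Mq qz.
  move: h => /= z'y; do 2 eexists.
  apply: (@wchain1 _ _ _ _ _ _ _ _ _ t) => //; first by case/andP: tT.
  apply: le_lt_trans (metric_triangle _ (F t z) _) _.
  have := hr t _ _ tT qz; move: zz'; rewrite z'y /d' lt_min => /andP[_]; lra.
have xz' : bounded_steps d' T (m + 1) x z'.
  by apply: bounded_steps_cat xz _; exists t, z'.
have {}h : bounded_steps d' T n.+1 z' y := h.
have [q' Mq'] := hd _ _ _ (bounded_steps_le d'd xz') (bounded_steps_le d'd h).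
rewrite lt_min => /andP[z'r z'e].
apply: (@reach_cat _ _ _ _ _ _ _ _ q'); last first.
  by apply: ih h xz' Mq' _; rewrite metric_sym.
do 2 eexists; apply: (@wchain1 _ _ _ _ _ _ _ _ _ t) => //; first by case/andP: tT.
apply: le_lt_trans (metric_triangle _ (F t z) _) _.
have := metric_triangle (F t z) z' q'.
have := hr t _ _ tT qz; move: zz'; rewrite /d' lt_min => /andP[_]; lra.
Qed.

End internal_chain_transitivity.

(** * Mean values along chains, and convexity of the spectrum of a component *)

Section mean_values.
Context {R : realType} {X : metricType R}.
Variables (F : R -> X -> X) (w : R -> X -> R).
Implicit Types (M : set X) (x y : X) (eps T t tau s lambda : R).

Local Notation wchain := (wchain F w).
Local Open Scope convex_scope.

(** The Morse spectrum for an arbitrary flow and weight, with one chain for each choice of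
    tolerances in place of sequences of chains; [morse_spectrumE] identifies the two. *)
Definition mean_spectrum M : set R :=
  [set lambda | forall eps T e, 0 < eps -> 0 < T -> 0 < e ->
    exists x y tau s, wchain M eps T x y tau s /\ `|tau^-1 * s - lambda| < e].

Lemma wchain_iter M eps T x tau s n : wchain M eps T x x tau s ->
  wchain M eps T x x (tau * n.+1%:R) (s * n.+1%:R).
Proof.
move=> h; elim: n => [|n ih]; first by rewrite !mulr1.
by rewrite -addn1 natrD !mulrDr !mulr1; exact: wchain_cat ih h.
Qed.

(** Clearing the denominator makes the error additive under concatenation of chains. *)
Lemma mean_near (lambda e tau s : R) : 0 < tau ->
  (`|tau^-1 * s - lambda| < e) = (`|s - lambda * tau| < e * tau).
Proof.
move=> tau0; rewrite -(ltr_pM2r tau0) -[X in _ * X < _]gtr0_norm// -normrM.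
by rewrite mulrBl mulrAC mulVf ?gt_eqF// mul1r.
Qed.

Hypotheses (flowF : is_flow F) (compactX : compact [set: X]).

(** Ever finer and longer chains have pairs of endpoints clustering at some [(x, y)] with both
    points in [M]. One fixed chain from [y] to [x] closes them up; its time and weight do not depend
    on [k], so they become negligible against the growing total time. *)
Lemma mean_spectrum_loop M lambda eps T e : chain_component F M ->
  mean_spectrum M lambda -> 0 < eps -> 0 < T -> 0 < e ->
  exists x tau s, wchain M eps T x x tau s /\ `|tau^-1 * s - lambda| < e.
Proof.
move=> cM lM eps0 T0 e0.
have pick k : exists u : X * X, exists tau s,
    wchain M k.+1%:R^-1 k.+1%:R u.1 u.2 tau s /\
    `|tau^-1 * s - lambda| < k.+1%:R^-1.
  have [|||x [y [tau [s h]]]] := lM k.+1%:R^-1 k.+1%:R k.+1%:R^-1 => //.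
  by exists (x, y), tau, s.
have [u hu] := choice pick.
have eps2 : 0 < eps / 2 by rewrite divr_gt0.
have cXX : compact [set: X * X].
  by rewrite -setXTT; exact: compact_setX.
have [[x y] uxy] := compact_cluster_seq u cXX.
have clM := chain_component_closed w flowF cM.
have uM k : M (u k).1 /\ M (u k).2.
  by have [tau [s [h _]]] := hu k; exact: wchain_endpoints h.
have small d : 0 < d -> \forall k \near \oo, k.+1%:R^-1 < d :> R.
  by move=> d0; exact: near_infty_natSinv_lt (PosNum d0).
have near_u d (P : set nat) : 0 < d -> (\forall k \near \oo, P k) ->
    exists2 k, P k & mdist x (u k).1 < d /\ mdist y (u k).2 < d.
  move=> d0 nP; have [k Pk] := cluster_seq_near uxy d0 nP.
  by rewrite gt_max => /andP[? ?]; exists k.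
have Mx : M x.
  apply: clM => B /nbhs_mdistP[d d0 dB].
  have [k _ [xu _]] := near_u d setT d0 filterT.
  by exists (u k).1; split; [exact: (uM k).1|exact: dB].
have My : M y.
  apply: clM => B /nbhs_mdistP[d d0 dB].
  have [k _ [_ yu]] := near_u d setT d0 filterT.
  by exists (u k).2; split; [exact: (uM k).2|exact: dB].
have [tc [sc hc]] := chain_component_reach w flowF compactX cM My Mx eps2 T0.
have tc0 : 0 < tc := lt_le_trans T0 (wchain_time_ge (ltW T0) hc).
(* Bounds the error [sc - lambda * tc] contributed by the closing chain. *)
pose C := `|sc| + `|lambda| * tc.
have [k [[kt KC] kd] [xu yu]] : exists2 k : nat,
    (T <= k.+1%:R /\ 2 * C / e <= k.+1%:R) /\
    k.+1%:R^-1 < Num.min (Num.min (eps / 2) (e / 2)) 1 &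
    mdist x (u k).1 < eps / 2 /\ mdist y (u k).2 < eps / 2.
  apply: near_u => //.
  have big r : \forall k \near \oo, r <= k.+1%:R :> R.
    near=> k; rewrite (@le_trans _ _ k%:R) ?ler_nat//.
    by near: k; exact: nbhs_infty_ger.
  apply: filterI; first by apply: filterI; exact: big.
  by apply: small; rewrite !lt_min eps2 divr_gt0//= ltr01.
have [tau [s [hk ls]]] := hu k.
move: kd; rewrite !lt_min => /andP[/andP[ke kee] k1].
(* The loop is based at the first endpoint of the long chain: the end of that chain is moved to [y],
   and the end of the closing chain to [(u k).1], each at a cost of [eps / 2]. *)
exists (u k).1, (tau + tc), (s + sc); split.
  rewrite (splitr eps); apply: (@wchain_cat _ _ _ _ _ _ _ _ y).
    apply: wchain_move_last My _; last first.
      by rewrite metric_sym; exact: yu.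
    by apply: wchain_sub (@subset_refl _ M) (ltW ke) kt hk.
  exact: wchain_move_last hc (uM k).1 xu.
have Ktau : k.+1%:R <= tau by apply: wchain_time_ge hk.
have tau0 : 0 < tau by apply: lt_le_trans Ktau.
have {ls} := lt_trans ls kee; rewrite !mean_near ?addr_gt0// => ls.
have -> : s + sc - lambda * (tau + tc) = (s - lambda * tau) + (sc - lambda * tc) by ring.
apply: le_lt_trans (ler_normD _ _) _.
have h : `|sc - lambda * tc| <= C.
  by rewrite (le_trans (ler_normB _ _))// normrM (gtr0_norm tc0).
have Ce : C <= e / 2 * tau.
  move: KC; rewrite ler_pdivrMr// => KC.
  have : k.+1%:R * e <= tau * e by rewrite ler_pM2r.
  lra.
have : 0 < e * tc by rewrite mulr_gt0.
lra.
Unshelve. all: by end_near. Qed.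


(** Two loops with means near [l1] and [l2] are run [n1.+1] and [n2.+1] times, taking about the
    fractions [b] and [1 - b] of a large time [N], with a single connecting chain from the first to
    the second. *)
Lemma mean_spectrum_convex M : chain_component F M ->
  @convex_set R R^o (mean_spectrum M).
Proof.
move=> cM l1 l2 a /set_mem l1M /set_mem l2M; apply/mem_set => eps T e eps0 T0 e0.
pose b : R := a%:num; have b0 : 0 <= b by rewrite /b.
have b1 : b <= 1 by rewrite /b.
have -> : l1 <| a |> l2 = b * l1 + (1 - b) * l2 :> R.
  by [].
have e20 : 0 < e / 2 by rewrite divr_gt0.
have [x [t1 [s1 [h1 m1]]]] := mean_spectrum_loop cM l1M eps0 T0 e20.
have [y [t2 [s2 [h2 m2]]]] := mean_spectrum_loop cM l2M eps0 T0 e20.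
have [Mx _] := wchain_endpoints h1; have [My _] := wchain_endpoints h2.
have [tc [sc hc]] := chain_component_reach w flowF compactX cM Mx My eps0 T0.
have time0 x1 x2 t s : wchain M eps T x1 x2 t s -> 0 < t.
  by move/(wchain_time_ge (ltW T0)); exact: lt_le_trans.
have t10 := time0 _ _ _ _ h1; have t20 := time0 _ _ _ _ h2.
have tc0 := time0 _ _ _ _ hc.
pose l := b * l1 + (1 - b) * l2.
(* Collects the errors that do not grow with the multiplicities: rounding by at most one turn of
   each loop, and the connecting chain. The time [N] is then chosen so that [C < e / 2 * N]. *)
pose C := `|l1 - l| * t1 + `|l2 - l| * t2 + `|sc| + `|l| * tc.
pose N := 2 * C / e + 1.
have C0 : 0 <= C by rewrite !addr_ge0// mulr_ge0// ltW.
have N0 : 0 < N by rewrite ltr_wpDl// divr_ge0 ?mulr_ge0 ?(ltW e0).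
have approx r t : 0 <= r -> 0 < t -> exists n, r <= t * n.+1%:R <= r + t.
  move=> r0 t0; have := truncn_itv (divr_ge0 r0 (ltW t0)).
  set n := Num.truncn _ => /andP[nr rn]; exists n; apply/andP; split.
    by rewrite mulrC -ler_pdivrMr// ltW.
  by rewrite -addn1 natrD mulrDr mulr1 lerD2r mulrC -ler_pdivlMr.
have [n1 /andP[n1l n1u]] := approx (b * N) t1 (mulr_ge0 b0 (ltW N0)) t10.
have [|n2 /andP[n2l n2u]] := approx ((1 - b) * N) t2 _ t20.
  by rewrite mulr_ge0 ?subr_ge0// ltW.
exists x, y, (t1 * n1.+1%:R + (tc + t2 * n2.+1%:R)),
  (s1 * n1.+1%:R + (sc + s2 * n2.+1%:R)); split.
  exact: wchain_cat (wchain_iter n1 h1) (wchain_cat hc (wchain_iter n2 h2)).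
move: m1 m2; rewrite !mean_near ?addr_gt0// ?mulr_gt0// -/l => m1 m2.
set k1 : R := n1.+1%:R in n1l n1u *; set k2 : R := n2.+1%:R in n2l n2u *.
have k10 : 0 < k1 by rewrite ltr0n. have k20 : 0 < k2 by rewrite ltr0n.
(* The terms in [N] may be inserted because [b * (l1 - l) + (1 - b) * (l2 - l)] vanishes. *)
have -> : s1 * k1 + (sc + s2 * k2) - l * (t1 * k1 + (tc + t2 * k2)) =
  (s1 - l1 * t1) * k1 + (s2 - l2 * t2) * k2 + (sc - l * tc) +
  ((l1 - l) * (t1 * k1 - b * N) + (l2 - l) * (t2 * k2 - (1 - b) * N)).
  rewrite /l; ring.
have d1 : `|(s1 - l1 * t1) * k1| <= e / 2 * (t1 * k1).
  by rewrite normrM (gtr0_norm k10) mulrA ler_pM2r// ltW.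
have d2 : `|(s2 - l2 * t2) * k2| <= e / 2 * (t2 * k2).
  by rewrite normrM (gtr0_norm k20) mulrA ler_pM2r// ltW.
have d3 : `|sc - l * tc| <= `|sc| + `|l| * tc.
  by rewrite (le_trans (ler_normB _ _))// normrM (gtr0_norm tc0).
have d4 : `|(l1 - l) * (t1 * k1 - b * N)| <= `|l1 - l| * t1.
  by rewrite normrM ler_wpM2l// ger0_norm ?subr_ge0// lerBlDl.
have d5 : `|(l2 - l) * (t2 * k2 - (1 - b) * N)| <= `|l2 - l| * t2.
  by rewrite normrM ler_wpM2l// ger0_norm ?subr_ge0// lerBlDl.
have NC : C < e / 2 * N.
  by rewrite /N mulrDr mulr1 [X in X + _](_ : _ = C) ?ltrDl//; field; rewrite gt_eqF.
have tN : N <= t1 * k1 + t2 * k2.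
  by rewrite (le_trans _ (lerD n1l n2l))// -mulrDl addrC subrK mul1r.
have etN : e / 2 * N <= e / 2 * (t1 * k1 + t2 * k2) by rewrite ler_pM2l.
have etc : 0 < e * tc by rewrite mulr_gt0.
apply: le_lt_trans (ler_normD _ _) _.
apply: le_lt_trans (lerD (ler_normD _ _) (ler_normD _ _)) _.
apply: le_lt_trans (lerD (lerD (ler_normD _ _) (lexx _)) (lexx _)) _.
move: NC; rewrite {1}/C; lra.
Qed.

End mean_values.

(** * Invariance of the spectrum under equivariant isometric embeddings *)

Section mean_spectrum_embedding.
Context {R : realType} {X X' : metricType R}.
Variables (F : R -> X -> X) (w : R -> X -> R).
Variables (F' : R -> X' -> X') (w' : R -> X' -> R) (E : X -> X').
Hypothesis E_isometry : forall x y, mdist (E x) (E y) = mdist x y.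
Hypothesis E_flow : forall t x, F' t (E x) = E (F t x).
Hypothesis E_weight : forall t x, w' t (E x) = w t x.

Let wchain_embed M eps T x y tau s : wchain F w M eps T x y tau s ->
  wchain F' w' (E @` M) eps T (E x) (E y) tau s.
Proof.
elim=> {x y tau s} [x y t Mx My Tt xy|x y z t tau s Mx Tt xy _ ih];
  rewrite -E_weight.
- by apply: wchain1 => //; rewrite E_flow E_isometry.
- by apply: wchainS ih => //; rewrite E_flow E_isometry.
Qed.

(** Points are pulled back one after the other from a given preimage of the first; the final point
    is left free, since the mean depends only on [tau] and [s]. *)
Let wchain_unembed M eps T x' y' tau s :
  wchain F' w' (E @` M) eps T x' y' tau s ->
  forall x, M x -> E x = x' -> exists y, wchain F w M eps T x y tau s.
Proof.
elim=> {x' y' tau s} [x' y' t _ [y My <-] Tt xy x Mx Ex|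
    x' y' z' t tau s _ Tt xy h ih x Mx Ex]; rewrite -{}Ex E_weight E_flow in xy *.
  by exists y; apply: wchain1; rewrite // -E_isometry.
have [[y My Ey] _] := wchain_endpoints h; have [z yz] := ih _ My Ey.
by exists z; apply: wchainS yz => //; rewrite -E_isometry Ey.
Qed.

Lemma mean_spectrum_embed M :
  mean_spectrum F' w' (E @` M) = mean_spectrum F w M.
Proof.
apply/seteqP; split=> lambda h eps T e eps0 T0 e0;
    have [x [y [tau [s [xy ts]]]]] := h _ _ _ eps0 T0 e0.
  have [[x' Mx' Ex] _] := wchain_endpoints xy.
  by have [y' h'] := wchain_unembed xy Mx' Ex; exists x', y', tau, s.
by exists (E x), (E y), tau, s; split=> //; exact: wchain_embed.
Qed.

End mean_spectrum_embedding.

(** * Projective spaces and projectivized flows *)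

Section finite_dimension.
Context {R : realType} {H : fdHilbertType R}.
Implicit Types (x y : H).

Local Notation e := (vbasis {:H}).

Let combi (v : 'rV[R]_(\dim {:H})) : H := \sum_i v ord0 i *: e`_i.

Let combi_coord x : combi (\row_i coord e i x) = x.
Proof.
rewrite /combi [RHS](coord_vbasis (memvf x)).
by apply: eq_bigr => i _; rewrite mxE.
Qed.

Let coord_combi v i : coord e i (combi v) = v ord0 i.
Proof. by rewrite coord_sum_free// (basis_free (vbasisP _)). Qed.

Let combi_continuous : continuous combi.
Proof.
apply: continuous_big => [x|i _ v]; first exact: add_continuous.
exact: (continuousZr_tmp (@coord_continuous R 1 (\dim {:H}) ord0 i v)).
Qed.

Let combi_norm_continuous : continuous (fun v => `|combi v|).
Proof. by move=> v; exact: (cvg_norm (@combi_continuous v)). Qed.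

(** One half of the equivalence of norms. The image of the unit sphere of coordinate vectors under
    the norm of [combi] is closed and misses 0, by freeness of the basis, so it stays away from 0;
    this covers dimension zero, where the sphere is empty. *)
Lemma coord_vbasis_bound :
  exists2 c : R, 0 < c & forall i x, `|coord e i x| <= c * `|x|.
Proof.
pose S := [set v : 'rV[R]_(\dim {:H}) | `|v| = 1].
have cS : compact S.
  apply: bounded_closed_compact.
    exists 1; split; first exact: num_real.
    by move=> r r1 v /= ->; exact: ltW.
  rewrite [S](_ : _ = Num.norm @^-1` [set 1])//.
  apply: preimage_closed; last exact: closed_eq.
  by move=> v _; exact: norm_continuous.
have clS : closed ((fun v => `|combi v|) @` S).
  apply: compact_closed; first exact: norm_hausdorff.
  by apply: continuous_compact cS; exact: continuous_subspaceT.
have [r r0 hr] : exists2 r : R, 0 < r & forall v, S v -> r <= `|combi v|.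
  have : nbhs (0 : R) (~` ((fun v => `|combi v|) @` S)).
    apply: open_nbhs_nbhs; split; first exact: closed_openC.
    move=> [v Sv /normr0_eq0 v0]; move: Sv; rewrite /S /=.
    suff -> : v = 0 by rewrite normr0 => /esym/eqP; rewrite oner_eq0.
    by apply/rowP => i; rewrite -coord_combi v0 linear0 mxE.
  move=> /nbhs_ballP[r /= r0 hr]; exists r => // v Sv.
  rewrite leNgt; apply/negP => vr; apply: (hr `|combi v|); last by exists v.
  by rewrite /ball /= sub0r normrN normr_id.
exists r^-1; first by rewrite invr_gt0.
move=> i x; pose v := \row_i coord e i x.
have [v0|v0] := eqVneq v 0.
  have -> : coord e i x = v ord0 i by rewrite mxE.
  by rewrite v0 mxE normr0 mulr_ge0 ?invr_ge0// ltW.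
have vgt0 : 0 < `|v| by rewrite normr_gt0.
have Sv : S (`|v|^-1 *: v).
  by rewrite /S /= normrZ ger0_norm ?invr_ge0// mulVf// gt_eqF.
have := hr _ Sv.
have -> : combi (`|v|^-1 *: v) = `|v|^-1 *: x.
  rewrite -[in RHS](combi_coord x) /combi scaler_sumr.
  by apply: eq_bigr => j _; rewrite mxE scalerA.
rewrite normrZ ger0_norm ?invr_ge0// ler_pdivlMl// => rv.
rewrite ler_pdivlMl//; apply: le_trans rv; rewrite mulrC ler_pM2r//.
have -> : coord e i x = v ord0 i by rewrite mxE.
rewrite [leRHS]/Num.norm /= mx_normrE.
exact: (@le_bigmax _ _ _ _ (fun ij => `|v ij.1 ij.2|) (ord0, i)).
Qed.

Lemma coord_vbasis_continuous i : continuous (coord e i : H -> R).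
Proof.
have [c c0 hc] := coord_vbasis_bound; move=> x.
apply/cvgrPdist_lt => /= d d0; near=> y.
rewrite -linearB (le_lt_trans (hc _ _))// -ltr_pdivlMl//.
near: y; apply: cvgr_dist_lt => //.
by rewrite mulr_gt0// invr_gt0.
Unshelve. all: by end_near. Qed.

(** The sphere is the continuous image of a closed set of coordinate vectors, which is bounded by
    [coord_vbasis_bound]. *)
Lemma compact_sphere : compact [set x : H | `|x| = 1].
Proof.
have [c c0 hc] := coord_vbasis_bound.
rewrite (_ : [set x | _] = combi @` [set v | `|combi v| = 1]); last first.
  apply/seteqP; split=> [x /= x1|_ /= [v v1 <-]//].
  by exists (\row_i coord e i x); rewrite combi_coord.
apply: continuous_compact; first exact: continuous_subspaceT.
apply: bounded_closed_compact.
  exists c; split; first exact: num_real.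
  move=> r cr v /= v1; rewrite /Num.norm /= mx_normrE; apply: bigmax_le => [|[j i] _ /=].
    exact: ltW (lt_trans c0 cr).
  rewrite (ord1 j) -coord_combi (le_trans (hc _ _))// v1 mulr1; exact: ltW.
rewrite [X in closed X](_ : _ = (fun v => `|combi v|) @^-1` [set 1])//.
apply: preimage_closed; last exact: closed_eq.
by move=> v _; exact: combi_norm_continuous.
Qed.

End finite_dimension.

Section projective_space.
Context {R : realType} {H : fdHilbertType R}.
Local Notation PH := (proj_space H).
Implicit Types (x y u v : H) (p q : PH).

Lemma proj_pt_scale x y (x0 : x != 0) (y0 : y != 0) k :
  y = k *: x -> proj_pt y0 = proj_pt x0.
Proof.
move=> yk; apply/val_inj/eqP; rewrite /= eqEdim !dim_vline x0 y0 andbT.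
by rewrite -memvE yk memvZ// memv_line.
Qed.

Lemma proj_repr_pt x (x0 : x != 0) :
  exists2 k, k != 0 & proj_repr (proj_pt x0) = k *: x.
Proof.
have /vlineP[k kx] : proj_repr (proj_pt x0) \in <[x]>%VS by exact: memv_pick.
exists k => //; apply: contraTneq (proj_repr_neq0 (proj_pt x0)) => k0.
by rewrite kx k0 scale0r eqxx.
Qed.

Lemma mdist_proj_unit u v (u0 : u != 0) (v0 : v != 0) : `|u| = 1 -> `|v| = 1 ->
  mdist (proj_pt u0) (proj_pt v0) = Num.min `|u - v| `|u + v|.
Proof.
move=> u1 v1; transitivity (proj_dist (proj_pt u0) (proj_pt v0)) => //.
by rewrite proj_distE u1 v1 invr1 !scale1r.
Qed.

Lemma norm_normalize x : x != 0 -> `| `|x|^-1 *: x| = 1.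
Proof.
by move=> x0; rewrite normrZ ger0_norm ?invr_ge0// mulVf// normr_eq0.
Qed.

Lemma proj_pt_unit p : exists u, `|u| = 1 /\ exists u0 : u != 0, p = proj_pt u0.
Proof.
have r0 := proj_repr_neq0 p; have u1 := norm_normalize r0.
have u0 : `|proj_repr p|^-1 *: proj_repr p != 0.
  by rewrite -normr_eq0 u1 oner_eq0.
exists (`|proj_repr p|^-1 *: proj_repr p); split=> //; exists u0.
by rewrite -[LHS]proj_reprK; apply/esym/proj_pt_scale.
Qed.

(** The representative is taken with the sign that attains the minimum in the projective distance,
    so closeness of lines becomes closeness of vectors. *)
Lemma proj_pt_near u (u0 : u != 0) p : `|u| = 1 ->
  exists v, exists2 v0 : v != 0, p = proj_pt v0 & `|u - v| = mdist (proj_pt u0) p.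
Proof.
move=> u1; have [v [v1 [v0 ->]]] := proj_pt_unit p.
rewrite mdist_proj_unit//; case: leP => _; first by exists v, v0.
have Nv0 : - v != 0 by rewrite oppr_eq0.
exists (- v), Nv0; last by rewrite opprK.
by apply: (@proj_pt_scale _ _ _ _ (-1)); rewrite scaleN1r opprK.
Qed.

Lemma compact_proj_space : compact [set: PH].
Proof.
have [PH0|/set0P[p0 _]] := eqVneq [set: PH] set0; first by rewrite PH0; exact: compact0.
(* [p0] is a default value at the zero vector, never met on the sphere. *)
pose g x : PH := match pselect (is_true (x != 0)) with left x0 => proj_pt x0 | _ => p0 end.
have gE x (x0 : x != 0) : g x = proj_pt x0.
  rewrite /g; case: pselect => [x0'|//].
  by apply: (@proj_pt_scale _ _ _ _ 1); rewrite scale1r.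
have neq0 x : `|x| = 1 -> x != 0 by move=> x1; rewrite -normr_eq0 x1 oner_eq0.
rewrite (_ : [set: PH] = g @` [set x : H | `|x| = 1]); last first.
  apply/seteqP; split=> // p _; have [u [u1 [u0 ->]]] := proj_pt_unit p.
  by exists u => //; rewrite gE.
apply: continuous_compact compact_sphere.
apply/subspace_continuousP => x x1 B; rewrite [X in nbhs X _ -> _](gE x (neq0 x x1)).
move=> /nbhs_mdistP[r r0 rB].
have xr : \forall y \near x, `|x - y| < r.
  by apply: (@cvgr_dist_lt _ _ _ _ _ id).
apply: filterS xr => y xy y1; change (B (g y)); rewrite (gE y (neq0 y y1)); apply: rB.
by rewrite mdist_proj_unit// gt_min xy.
Qed.

Lemma proj_set_bundle_of (B : metricType R) (M : set (B * PH)) :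
  proj_set (bundle_of M) = M.
Proof.
apply/seteqP; split=> -[b p] /=; first by move=> [[x x0]] /= Mx ->; exact: Mx.
move=> Mbp; have reprE (r0 : proj_repr p != 0) : proj_pt r0 = p.
  by rewrite (@proj_pt_scale _ _ (proj_repr_neq0 p) r0 1) ?scale1r// proj_reprK.
exists (exist _ (proj_repr p) (proj_repr_neq0 p)) => /=; last by rewrite reprE.
by move=> r0; rewrite reprE.
Qed.

End projective_space.

(** * The flow on the projective bundle and its exponents *)

Section projectivized_flow.
Context {R : realType} {B : metricType R} {H : fdHilbertType R}.
Variables (theta : R -> B -> B) (phi : R -> B -> H -> H).
Hypothesis linF : linear_flow theta phi.
Local Notation PH := (proj_space H).
Local Notation PF := (proj_flow theta phi).

Lemma normalize_continuous (y : H) : y != 0 ->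
  {for y, continuous (fun x : H => `|x|^-1 *: x)}.
Proof.
move=> y0; apply: continuousZ; last exact: id.
by apply: continuousV; [rewrite normr_eq0|exact: norm_continuous].
Qed.

(** Continuity is checked on vectors: a line near that of [u] has a representative near [u], to
    which continuity of the linear flow and of normalization apply. *)
Lemma proj_flow_is_flow : is_flow PF.
Proof.
have [[cF F0 FD] _] := linF.
have neq0 t b x : x != 0 -> phi t b x != 0 by exact: linear_flow_neq0 linF.
split.
- move=> [t [b p]] A /nbhs_mdistP[e e0 eA].
  have [u [u1 [u0 pu]]] := proj_pt_unit p; rewrite {}pu in eA *.
  pose y := phi t b u; have y0 : y != 0 := neq0 t b u u0.
  pose W : set (B * H) := [set z | mdist (theta t b) z.1 < e /\
    `| `|y|^-1 *: y - `|z.2|^-1 *: z.2| < e].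
  have nW : nbhs (theta t b, y) W.
    exists ([set b' | mdist (theta t b) b' < e],
        [set z | `| `|y|^-1 *: y - `|z|^-1 *: z| < e]); last by move=> [? ?] [].
    split; first by apply/nbhs_mdistP; exists e.
    have nc : `|z|^-1 *: z @[z --> y] --> `|y|^-1 *: y := normalize_continuous y0.
    exact: (cvgr_dist_lt _ _ nc _ e0).
  have /= := cF (t, (b, u)) W nW.
  move=> [[A1 A2] /= [nA1 [[A3 A4] /= [nA3 nA4] A34]] A12].
  have [r /= r0 rA] := (nbhs_ballP _ _).1 nA4.
  exists (A1, A3 `*` [set q | mdist (proj_pt u0) q < r]).
    split=> //=; exists (A3, [set q | mdist (proj_pt u0) q < r]) => //; split=> //=.
    by apply/nbhs_mdistP; exists r.
  move=> [t' [b' q]] [/= At' [/= Ab' uq]].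
  have [v [v0 qv uv]] := proj_pt_near u0 q u1; rewrite {}qv in uv uq *.
  have [/= W1 W2] : W (skew_flow theta phi t' (b', v)).
    apply: (A12 (t', (b', v))); split=> //=; apply: (A34 (b', v)); split=> //=.
    by apply: rA; rewrite -ball_normE /= uv.
  apply: eA; rewrite !(proj_flowE _ (neq0 _ _ _ _) linF)//.
  change (Num.max (mdist (theta t b) (theta t' b'))
    (proj_dist (proj_pt y0) (proj_pt (neq0 t' b' v v0))) < e).
  by rewrite gt_max W1/= proj_distE gt_min W2.
- move=> [b p]; have [u [u1 [u0 ->]]] := proj_pt_unit p.
  rewrite (proj_flowE _ (neq0 0 b u u0) linF).
  have [-> u00] := F0 (b, u); congr (_, _).
  by apply: (@proj_pt_scale _ _ _ _ _ _ 1); rewrite scale1r u00.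
- move=> t s [b p]; have [u [u1 [u0 ->]]] := proj_pt_unit p.
  rewrite (proj_flowE _ (neq0 (t + s) b u u0) linF).
  rewrite (proj_flowE _ (neq0 s b u u0) linF).
  rewrite (proj_flowE _ (neq0 t _ _ (neq0 s b u u0)) linF).
  have [-> uE] := FD t s (b, u); congr (_, _).
  by apply: (@proj_pt_scale _ _ _ _ _ _ 1); rewrite scale1r uE.
Qed.

Definition proj_weight (t : R) (z : B * PH) : R :=
  let x := proj_repr z.2 in ln `|phi t z.1 x| - ln `|x|.

(** Rescaling the representative adds the same constant to both logarithms. *)
Lemma proj_weightE t b (x : H) (x0 : x != 0) :
  proj_weight t (b, proj_pt x0) = ln `|phi t b x| - ln `|x|.
Proof.
have [k k0 kx] := proj_repr_pt x0; rewrite /proj_weight /= kx.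
have -> : phi t b (k *: x) = k *: phi t b x.
  by have := linF.2 t b k x 0; have := linF.2 t b (-1) 0 0;
     rewrite !scaler0 !addr0 scaleN1r addNr => ->; rewrite addr0.
rewrite !normrZ !lnM ?posrE ?normr_gt0//; last exact: linear_flow_neq0 linF x0.
by rewrite opprD addrACA subrr add0r.
Qed.

Lemma morse_spectrumE V :
  morse_spectrum theta phi V = mean_spectrum PF proj_weight (proj_set V).
Proof.
apply/seteqP; split=> lambda.
  move=> [eps [T [z [eps0 Too hz hl]]]] e' T' d e'0 T'0 d0.
  have nd : \forall k \near \oo, `|lambda - chain_exponent phi (z k)| < d.
    exact: (cvgr_dist_lt _ _ hl _ d0).
  have ne : \forall k \near \oo, eps k < e' by exact: (cvgr_lt _ eps0).
  have nT : \forall k \near \oo, T' <= T k by move/cvgryPge: Too; exact.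
  have [k [[kd ke] kT]] := filter_ex (filterI (filterI nd ne) nT).
  have [_ _ cz Vz] := hz k.
  exists (chain_pt (z k) 0), (chain_pt (z k) (chain_size (z k))).
  exists (chain_total_time (z k)).
  exists (\sum_(i < chain_size (z k)) proj_weight (chain_time (z k) i) (chain_pt (z k) i)).
  split; last by rewrite distrC.
  apply: wchain_sub (@subset_refl _ _) (ltW ke) kT _.
  by apply/wchainP; exists (z k).
move=> h.
have pick k : exists z : chain (B * PH), [/\ is_chain PF k.+1%:R^-1 k.+1%:R z,
    forall i, (i <= chain_size z)%N -> proj_set V (chain_pt z i) &
    `|chain_exponent phi z - lambda| < k.+1%:R^-1].
  have [|||x [y [tau [s [/wchainP[z [cz Vz _ tz sz]] zl]]]]] :=
    h k.+1%:R^-1 k.+1%:R k.+1%:R^-1 => //.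
  by exists z; split=> //; rewrite /chain_exponent /chain_total_time tz sz.
have [z hz] := choice pick.
exists (fun k => k.+1%:R^-1), (fun k => k.+1%:R), z; split.
- exact: cvg_harmonic.
- apply/cvgryPge => r; near=> k; rewrite (@le_trans _ _ k%:R) ?ler_nat//.
  by near: k; exact: nbhs_infty_ger.
- by move=> k; have [? ? ?] := hz k; split.
- apply/cvgrPdist_lt => e e0; near=> k; have [_ _ zk] := hz k.
  rewrite distrC (lt_trans zk)//; near: k.
  exact: near_infty_natSinv_lt (PosNum e0).
Unshelve. all: by end_near. Qed.

End projectivized_flow.

(** * The cocycle identity of the forcing term *)

Section oriented_integral.
Context {R : realType}.
Local Notation mu := (@lebesgue_measure R).
Implicit Types (a b c s : R) (g h : R -> R).

Definition segment_integrable g : Prop := measurable_fun [set: R] g /\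
  forall a b, mu.-integrable `[a, b] (EFin \o g).

Lemma oriented_integralC a b g : oriented_integral b a g = - oriented_integral a b g.
Proof.
rewrite /oriented_integral; have [ab|ba|->] := ltgtP a b.
- by [].
- by rewrite opprK.
- by rewrite set_itv1 Rintegral_set1 oppr0.
Qed.

Lemma oriented_integral_chasles g : segment_integrable g -> forall a b c,
  oriented_integral a b g + oriented_integral b c g = oriented_integral a c g.
Proof.
move=> [mg ig].
have sorted a b c : a <= b -> b <= c ->
    oriented_integral a b g + oriented_integral b c g = oriented_integral a c g.
  move=> ab bc; rewrite /oriented_integral ab bc (le_trans ab bc).
  have := @Rintegral_itvB _ g (BLeft a) (BRight c) b (ig a c).
  rewrite !bnd_simp => /(_ ab bc).
  rewrite Rintegral_itv_obnd_cbnd; first lra.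
  by apply: integrableS (ig b c) => //; apply: subset_itvr; rewrite bnd_simp.
move=> a b c.
(* For any order of the three points, reversing integrals reduces the claim to the sorted case. *)
have := oriented_integralC a b g; have := oriented_integralC b c g.
have := oriented_integralC a c g.
have [ab|/ltW ba] := leP a b; have [bc|/ltW cb] := leP b c;
  have [ac|/ltW ca] := leP a c.
- by rewrite sorted.
- by rewrite sorted.
- by have := sorted _ _ _ ac cb; lra.
- by have := sorted _ _ _ ca ab; lra.
- by have := sorted _ _ _ ba ac; lra.
- by have := sorted _ _ _ bc ca; lra.
- by have := sorted _ _ _ cb ba; lra.
- by have := sorted _ _ _ cb ba; lra.
Qed.

Lemma segment_integrableZ k g :
  segment_integrable g -> segment_integrable (fun x => k * g x).
Proof.
move=> [mg ig]; split=> [|a b]; first exact: measurable_funM.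
rewrite (_ : _ \o _ = fun x => (k%:E * (EFin \o g) x)%E)//.
exact: integrableZl.
Qed.

Lemma segment_integrable_sum n (g : 'I_n -> R -> R) :
  (forall i, segment_integrable (g i)) ->
  segment_integrable (fun x => \sum_i g i x).
Proof.
move=> hg; split=> [|a b]; first by apply: measurable_sum => i; have [] := hg i.
rewrite (_ : _ \o _ = fun x => (\sum_i (EFin \o g i) x)%E); last first.
  by apply/funext => x /=; rewrite sumEFin.
by apply: integrable_sum => // i _; have [_] := hg i; exact.
Qed.

Lemma Rintegral_sum n (k : 'I_n -> R) (g : 'I_n -> R -> R) a b :
  (forall i, segment_integrable (g i)) ->
  \int[mu]_(x in `[a, b]) (\sum_i k i * g i x) =
  \sum_i k i * \int[mu]_(x in `[a, b]) g i x.
Proof.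
move=> hg; elim: n k g hg => [|n ih] k g hg.
  rewrite big_ord0; under eq_Rintegral do rewrite big_ord0.
  by rewrite Rintegral_cst// mul0r.
rewrite big_ord_recl; under eq_Rintegral do rewrite big_ord_recl.
have [_ i0] := segment_integrableZ (k ord0) (hg ord0).
have [_ iS] := segment_integrable_sum
  (fun i => segment_integrableZ (k (lift ord0 i)) (hg (lift ord0 i))).
rewrite RintegralD//; congr (_ + _); last by rewrite ih.
by rewrite RintegralZl//; have [_] := hg ord0; exact.
Qed.

Lemma oriented_integral_sum n (k : 'I_n -> R) (g : 'I_n -> R -> R) a b :
  (forall i, segment_integrable (g i)) ->
  oriented_integral a b (fun x => \sum_i k i * g i x) =
  \sum_i k i * oriented_integral a b (g i).
Proof.
move=> hg; rewrite /oriented_integral; case: ifP => _; rewrite Rintegral_sum//.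
by rewrite -sumrN; apply: eq_bigr => i _; rewrite mulrN.
Qed.

(** Both measures agree on half-open intervals, which determines Lebesgue measure. *)
Lemma lebesgue_measure_shift s (A : set R) : measurable A ->
  pushforward mu ((fun x => x + s) : R -> measurableTypeR R) A = mu A.
Proof.
move=> mA; apply/esym/lebesgue_measure_unique => //=.
  exact: measurable_funD.
move=> _ ms [[a b]] _ <-.
rewrite /pushforward (_ : _ @^-1` _ = `]a - s, b - s]%classic); last first.
  by apply/seteqP; split => x; rewrite /= !in_itv/= ltrBlDr lerBrDr.
rewrite !lebesgue_measure_itv/= !lte_fin ltrD2r.
by case: ifP => // _; rewrite -!EFinB; congr EFin; ring.
Qed.

Lemma oriented_integral_shift g a b s : segment_integrable g ->
  oriented_integral (a + s) (b + s) g = oriented_integral a b (fun x => g (x + s)).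
Proof.
move=> [mg ig].
have shift c d : \int[mu]_(x in `[c + s, d + s]) g x = \int[mu]_(x in `[c, d]) g (x + s).
  congr fine.
  pose sh : measurableTypeR R -> measurableTypeR R := fun x => x + s.
  have preE : sh @^-1` `[c + s, d + s] = `[c, d]%classic.
    by apply/seteqP; split => x; rewrite /sh /= !in_itv/= !lerD2r.
  have mgE : measurable_fun [set: measurableTypeR R] (EFin \o g) by exact/measurable_EFinP.
  have ms : measurable_fun [set: measurableTypeR R] sh by exact: measurable_funD.
  have cg : measurable_fun [set: measurableTypeR R] ((EFin \o g) \o sh).
    exact: measurableT_comp.
  have shE (h : R -> \bar R) : (\int[mu]_(x in `[(c + s)%R, (d + s)%R]) h x =
      \int[pushforward mu sh]_(x in `[(c + s)%R, (d + s)%R]) h x)%E.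
    by apply: eq_measure_integral => A mA _; exact/esym/lebesgue_measure_shift.
  rewrite shE -preE.
  apply: (integral_pushforward ms mgE) => //.
  have /integrableP[_ fin] := ig (c + s) (d + s).
  apply/integrableP; split; first exact: measurable_funTS.
  apply: le_lt_trans fin.
  rewrite shE ge0_integral_pushforward//.
  by apply: measurable_funTS; exact: measurableT_comp.
by rewrite /oriented_integral lerD2r !shift.
Qed.

Lemma eq_ae_oriented_integral a b g h : measurable_fun [set: R] g ->
  measurable_fun [set: R] h -> {ae mu, forall x, g x = h x} ->
  oriented_integral a b g = oriented_integral a b h.
Proof.
move=> mg mh gh.
have ae_int c d : \int[mu]_(x in `[c, d]) g x = \int[mu]_(x in `[c, d]) h x.
  congr fine; apply: ae_eq_integral => //.
  - exact/measurable_EFinP/measurable_funTS.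
  - exact/measurable_EFinP/measurable_funTS.
  - case: gh => N [mN N0 sN]; exists N; split=> // x /= nx.
    by apply: sN => gx; apply: nx => _; rewrite /= gx.
by rewrite /oriented_integral !ae_int.
Qed.

End oriented_integral.

Section almost_everywhere.
Context {R : realType}.
Local Notation mu := (@lebesgue_measure R).

(** Tonelli: the measure of a null set of the product is the integral of the measures of its
    sections, so almost every section is null. *)
Lemma ae_section (P : R -> R -> Prop) :
  {ae (mu \x mu)%E, forall z : R * R, P z.1 z.2} ->
  {ae mu, forall y, {ae mu, forall x, P x y}}.
Proof.
move=> [A [mA A0 PA]].
(* [\x^] integrates over the second coordinate last, which yields sections at fixed [y]; it agrees
   with [\x] by uniqueness of the product measure. *)
have A0' : (\int[mu]_y (mu (ysection A y)) = 0)%E.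
  rewrite -[RHS]A0; apply/esym.
  apply: (@product_measure_unique _ _ _ _ R mu mu (mu \x^ mu)%E) => //.
  by move=> A1 A2 mA1 mA2; exact: product_measure2E.
have mys : measurable_fun [set: R] (fun y => mu (ysection A y)).
  exact: measurable_fun_ysection.
have [N [mN N0 NA]] : ae_eq mu [set: R] (fun y => mu (ysection A y)) (cst 0%E).
  apply/(ae_eq_integral_abs mu measurableT mys).
  by under eq_integral do rewrite gee0_abs//.
exists N; split=> // y nPy; apply: NA => /= yA; apply: nPy.
exists (ysection A y); split; first exact: measurable_ysection.
  exact: yA.
by move=> x nP; rewrite /ysection /= inE; exact: PA.
Qed.

(** The points where two continuous functions differ form an open set; if nonempty, it contains a
    ball, which has positive measure. *)
Lemma ae_dense_eq (V : normedModType R) (g h : R -> V) :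
  continuous g -> continuous h -> {ae mu, forall s, g s = h s} -> g =1 h.
Proof.
move=> cg ch [N [mN N0 gN]] s; apply: contrapT => /eqP ghs.
have cgh : continuous (fun s => g s - h s).
  by move=> r; exact: (cvgB (cg r) (ch r)).
have d0 : 0 < `|g s - h s| by rewrite normr_gt0 subr_eq0.
have : nbhs s [set t | `|g s - h s - (g t - h t)| < `|g s - h s|].
  exact: (cvgr_dist_lt _ _ (cgh s) _ d0).
move=> /nbhs_ballP[r /= r0 sr].
have : (mu (ball s r) <= mu N)%E.
  apply: le_measure; rewrite ?inE//; first exact: measurable_ball.
  move=> t bt; apply: gN => /= gh; have /= := sr t bt.
  by rewrite gh subrr subr0 ltxx.
by rewrite N0 lebesgue_measure_ball ?(ltW r0)// leNgt lte_fin mulrn_wgt0.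
Qed.

Lemma segment_integrable_mul (A c : R -> R) (C : R) :
  continuous A -> measurable_fun [set: R] c ->
  {ae mu, forall x, `|c x| <= C} -> segment_integrable (fun x => A x * c x).
Proof.
move=> cA mc cC; have mA : measurable_fun [set: R] A by exact: continuous_measurable_fun.
split=> [|a b]; first exact: measurable_funM.
have cAb : compact (A @` `[a, b]).
  by apply: continuous_compact; [exact: continuous_subspaceT|exact: segment_compact].
have [K [_ hK]] := compact_bounded cAb.
(* The bound holds for every constant above [K]; this one is moreover positive. *)
pose K1 := Num.max K 0 + 1.
have KK1 : K < K1 by rewrite /K1 ltr_pwDr// le_max lexx.
have K10 : 0 < K1 by rewrite /K1 ltr_pwDr// le_max lexx orbT.
have {}hK x : x \in `[a, b] -> `|A x| <= K1.
  by move=> xab; apply: hK KK1 _ _; exists x.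
have mAc : measurable_fun `[a, b] (EFin \o (fun x => A x * c x)).
  by apply/measurable_EFinP/measurable_funTS; exact: measurable_funM.
apply/integrableP; split => //.
apply: (@le_lt_trans _ _ (\int[mu]_(x in `[a, b]) (cst (K1 * `|C|)%:E) x)%E).
  apply: ae_ge0_le_integral => //.
  - exact: measurableT_comp.
  - by move=> x _; rewrite /= lee_fin mulr_ge0 ?(ltW K10).
  - case: cC => N [mN N0 cN]; exists N; split=> // x /= nx; apply: cN => cx.
    apply: nx => xab; rewrite /= lee_fin normrM ler_pM//; first exact: hK.
    exact: le_trans (ler_norm C).
rewrite integral_cst//= lebesgue_measure_itv/=; case: ifP => _.
  by rewrite -EFinB -EFinM ltry.
by rewrite mule0 ltry.
Qed.

End almost_everywhere.

Section forcing_cocycle.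
Context {R : realType} {B : metricType R} {H : fdHilbertType R}.
Local Notation mu := (@lebesgue_measure R).
Local Notation e := (vbasis {:H}).
Variables (theta : R -> B -> B) (phi : R -> B -> H -> H).
Hypothesis linF : linear_flow theta phi.

Lemma cocycle0 t b : phi t b 0 = 0.
Proof.
by have := linF.2 t b (-1) 0 0; rewrite !scaler0 !addr0 scaleN1r addNr.
Qed.

Lemma cocycleZ t b k x : phi t b (k *: x) = k *: phi t b x.
Proof. by have := linF.2 t b k x 0; rewrite !addr0 cocycle0 addr0. Qed.

Lemma cocycleD t b x y : phi t b (x + y) = phi t b x + phi t b y.
Proof. by have := linF.2 t b 1 x y; rewrite !scale1r. Qed.

(** Matrix form of the cocycle. It separates continuous entries from the measurable coordinates of
    [f b], and it lets [phi t] pass under the integral. *)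
Lemma cocycle_coord t b x i : coord e i (phi t b x) =
  \sum_(j < \dim {:H}) coord e i (phi t b e`_j) * coord e j x.
Proof.
rewrite {1}(coord_vbasis (memvf x)).
rewrite (big_morph (phi t b) (cocycleD t b) (cocycle0 t b)) linear_sum.
by apply: eq_bigr => j _; rewrite cocycleZ linearZ /= mulrC.
Qed.

Lemma base_flowE t s b : theta (t + s) b = theta t (theta s b).
Proof. by have [[_ _ FD] _] := linF; have [] := FD t s (b, 0). Qed.

Lemma cocycleE t s b x : phi (t + s) b x = phi t (theta s b) (phi s b x).
Proof. by have [[_ _ FD] _] := linF; have [] := FD t s (b, x). Qed.

Lemma cocycle_continuous :
  continuous (fun z : R * (B * H) => phi z.1 z.2.1 z.2.2).
Proof.
have [[cF _ _] _] := linF => z.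
exact: (continuous_comp (cF z) (@snd_continuous _ _ _)).
Qed.

Lemma base_flow_continuous b : continuous (theta ^~ b).
Proof.
have [[cF _ _] _] := linF.
have h : continuous (fun t : R => (t, (b, 0 : H))).
  by apply: continuous_pair => t; [exact: id|exact: cst_continuous].
move=> t; have h1 := continuous_comp (h t) (cF _).
exact: (continuous_comp h1 (@fst_continuous _ _ _)).
Qed.

Variable f : B -> R -> H.
Hypothesis f_Linfty : forall b, in_Linfty (f b).

Lemma in_Linfty_coord b j : measurable_fun [set: R] (fun r => coord e j (f b r)) /\
  exists C : R, {ae mu, forall r, `|coord e j (f b r)| <= C}.
Proof.
have [mf fb] := f_Linfty b; split.
  apply: (measurability _ (RGenOInfty.measurableE R)) => _ [_ [x ->] <-].
  rewrite setTI.
  have := mf measurableT (coord e j @^-1` `]x, +oo[).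
  rewrite setTI; apply; apply: sub_sigma_algebra.
  apply: open_comp; last exact: rray_open.
  by move=> y _; exact: coord_vbasis_continuous.
have [c c0 hc] := @coord_vbasis_bound R H.
have [K [N [mN N0 fN]]] : exists K : R, {ae mu, forall r, `|f b r| <= K}.
  have := ess_sup_ge mu (fun t => `|f b t|%:E).
  case: (ess_sup _ _) fb => [K| |] // _ [N [mN N0 sN]]; [exists K|exists 0];
    exists N; split=> // x /= nx; apply: sN => h; apply: nx.
  by rewrite -lee_fin.
exists (c * K), N; split=> // r /= nr; apply: fN => fr; apply: nr.
by rewrite (le_trans (hc _ _))// ler_pM2l.
Qed.

Definition kernel t b (i : 'I_(\dim {:H})) r :=
  coord e i (phi (t - r) (theta r b) (f b r)).

Lemma kernel_segment_integrable t b i : segment_integrable (kernel t b i).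
Proof.
rewrite (_ : kernel t b i = fun r =>
    \sum_(j < \dim {:H}) coord e i (phi (t - r) (theta r b) e`_j) *
      coord e j (f b r)); last first.
  by apply/funext => r; rewrite /kernel cocycle_coord.
apply: segment_integrable_sum => j.
have [mc [C hC]] := in_Linfty_coord b j.
apply: (segment_integrable_mul _ mc hC).
have h : continuous (fun r : R => (t - r, (theta r b, e`_j))).
  apply: continuous_pair => [r|].
    by apply: (@continuousB _ _ _ (cst t) id); [exact: cst_continuous|exact: id].
  by apply: continuous_pair => r; [exact: base_flow_continuous|exact: cst_continuous].
move=> r; have h1 := continuous_comp (h r) (@cocycle_continuous _).
exact: (continuous_comp h1 (@coord_vbasis_continuous _ _ _ _)).
Qed.

Lemma coord_forcing t b i :
  coord e i (forcing theta phi f t b) = oriented_integral 0 t (kernel t b i).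
Proof.
by rewrite /forcing /vector_integral coord_sum_free// (basis_free (vbasisP _)).
Qed.

(** The integral is split at [s]. Between 0 and [s] the cocycle law takes [phi t] out of the
    integral; the rest is translated by [s], where the hypothesis replaces [f b] by [f (theta s b)]
    almost everywhere. *)
Lemma forcingD_ae t s b :
  {ae mu, forall u, f b (u + s) = f (theta s b) u} ->
  forcing theta phi f (t + s) b =
  phi t (theta s b) (forcing theta phi f s b) + forcing theta phi f t (theta s b).
Proof.
move=> fs.
rewrite [LHS](coord_vbasis (memvf _)) [RHS](coord_vbasis (memvf _)).
apply: eq_bigr => i _; congr (_ *: _); rewrite linearD/= cocycle_coord !coord_forcing.
have ik := kernel_segment_integrable (t + s) b i.
rewrite -(oriented_integral_chasles ik 0 s); congr (_ + _).
  under [RHS]eq_bigr do rewrite coord_forcing.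
  rewrite -oriented_integral_sum; last by move=> j; exact: kernel_segment_integrable.
  congr (oriented_integral 0 s _); apply/funext => r.
  by rewrite /kernel -cocycle_coord -addrA cocycleE -base_flowE subrK.
rewrite -{1}[s]add0r oriented_integral_shift//.
apply: eq_ae_oriented_integral.
- have [mk _] := ik; apply: (measurableT_comp mk); exact: measurable_funD.
- by have [] := kernel_segment_integrable t (theta s b) i.
case: fs => N [mN N0 fN]; exists N; split=> // u /= nu; apply: fN => fu; apply: nu.
by rewrite /kernel fu base_flowE opprD addrACA subrr addr0.
Qed.

Variable psi : R -> B -> H -> H.
Hypothesis Psi_affine : affine_flow theta phi f psi.

Lemma forcing_psi t b : forcing theta phi f t b = psi t b 0.
Proof. by have [_ _ _ -> _] := Psi_affine; rewrite cocycle0 add0r. Qed.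

(** The forcing term is the value of [psi] at the zero vector, so its continuity is inherited from
    the affine flow. *)
Lemma forcing_continuous :
  continuous (fun z : R * B => forcing theta phi f z.1 z.2).
Proof.
have [_ _ _ _ cpsi] := Psi_affine.
rewrite (_ : (fun _ => _) = fun z : R * B => psi z.1 z.2 0); last first.
  by apply/funext => z; rewrite forcing_psi.
have h : continuous (fun z : R * B => (z.1, (z.2, 0 : H))).
  apply: continuous_pair => [z|]; first exact: fst_continuous.
  by apply: continuous_pair => z; [exact: snd_continuous|exact: cst_continuous].
move=> z; have h1 := continuous_comp (h z) (cpsi _).
exact: (continuous_comp h1 (@snd_continuous _ _ _)).
Qed.

(** For almost every [s], [ae_section] supplies the hypothesis of [forcingD_ae]; both sides being
    continuous in [s], the identity extends to every [s]. *)
Lemma forcingD t s b : forcing theta phi f (t + s) b =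
  phi t (theta s b) (forcing theta phi f s b) + forcing theta phi f t (theta s b).
Proof.
have [_ _ fae _ _] := Psi_affine; move: s.
have cforce (g : R -> R) (h : R -> B) : continuous g -> continuous h ->
    continuous (fun s => forcing theta phi f (g s) (h s)).
  move=> cg ch s; have := continuous_pair cg ch.
  by move=> /(_ s) c1; exact: (continuous_comp c1 (@forcing_continuous _)).
apply: ae_dense_eq.
- apply: cforce => s; last exact: cst_continuous.
  by apply: (@continuousD _ _ _ (cst t) id); [exact: cst_continuous|exact: id].
- have c1 : continuous (fun s => forcing theta phi f t (theta s b)).
    by apply: cforce => s; [exact: cst_continuous|exact: base_flow_continuous].
  have c2 : continuous (fun s : R => (t, (theta s b, forcing theta phi f s b))).
    apply: continuous_pair => [s|]; first exact: cst_continuous.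
    apply: continuous_pair; first exact: base_flow_continuous.
    by apply: cforce => s; [exact: id|exact: cst_continuous].
  move=> s; apply: (@continuousD _ _ _
    (fun s => phi t (theta s b) (forcing theta phi f s b))); last exact: c1.
  exact: (continuous_comp (c2 s) (@cocycle_continuous _)).
have [N [mN N0 sN]] :=
  @ae_section R (fun u s => f b (u + s) = f (theta s b) u) (fae b).
by exists N; split=> // s /= ns; apply: sN => fs; apply: ns; exact: forcingD_ae.
Qed.

End forcing_cocycle.

(** * The lift of an affine flow *)

Lemma continuous_contraction (R : realType) (V W : normedModType R) (g : V -> W) :
  (forall x y, `|g x - g y| <= `|x - y|) -> continuous g.
Proof.
move=> hg x; apply/cvgrPdist_lt => d d0; near=> y; apply: le_lt_trans (hg _ _) _.
by near: y; apply: (@cvgr_dist_lt _ _ _ _ _ id).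
Unshelve. all: by end_near. Qed.

Lemma continuous_normP (R : realType) (S : topologicalType) (V : normedModType R)
    (g : S -> V) : continuous g <->
  forall x d, 0 < d -> \forall y \near x, `|g x - g y| < d.
Proof.
by split=> [cg x d d0|hg x]; [exact: (cvgr_dist_lt _ _ (cg x))|
  apply/cvgrPdist_lt; exact: hg].
Qed.

Section lift.
Context {R : realType} {H : fdHilbertType R}.
Local Notation H1 := (lift_space H).
Implicit Types z : H1.

Lemma lift_space_normE z : `|z| ^+ 2 = `|z.1| ^+ 2 + z.2 ^+ 2.
Proof. by rewrite -[LHS]hdot_norm -hdot_norm expr2. Qed.

Lemma lift_space_norm1 z : `|z.1| <= `|z|.
Proof.
by rewrite -(@ler_pXn2r _ 2)// ?nnegrE// lift_space_normE lerDl sqr_ge0.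
Qed.

Lemma lift_space_norm2 z : `|z.2| <= `|z|.
Proof.
rewrite -(@ler_pXn2r _ 2)// ?nnegrE// lift_space_normE real_normK ?num_real//.
by rewrite lerDr sqr_ge0.
Qed.

Lemma lift_space_norm_le z : `|z| <= `|z.1| + `|z.2|.
Proof.
rewrite -(@ler_pXn2r _ 2)// ?nnegrE ?addr_ge0// lift_space_normE sqrrD.
by rewrite (real_normK (num_real z.2)) lerD2r lerDl mulrn_wge0// mulr_ge0.
Qed.

Lemma lift_space_fst_continuous : continuous (fun z : H1 => z.1).
Proof.
apply: (@continuous_contraction R H1 H) => x y.
exact: lift_space_norm1 (x - y).
Qed.

Lemma lift_space_snd_continuous : continuous (fun z : H1 => z.2 : R).
Proof.
apply: (@continuous_contraction R H1 R^o) => x y.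
exact: lift_space_norm2 (x - y).
Qed.

Lemma lift_space_continuous (S : topologicalType) (g : S -> H) (h : S -> R) :
  continuous g -> continuous h -> continuous (fun x => (g x, h x) : H1).
Proof.
move=> cg ch; apply/(@continuous_normP R S H1) => x d d0; near=> y.
apply: le_lt_trans (lift_space_norm_le _) _; rewrite (splitr d) ltrD//=.
  by near: y; apply: (cvgr_dist_lt _ _ (cg x)); rewrite divr_gt0.
by near: y; apply: (cvgr_dist_lt _ _ (ch x)); rewrite divr_gt0.
Unshelve. all: by end_near. Qed.

Definition lift_infty (x : H) : H1 := (x, 0).

Lemma lift_infty_norm x : `|lift_infty x| = `|x|.
Proof.
apply/eqP; rewrite -(@eqrXn2 _ 2)//.
by rewrite lift_space_normE /= expr0n addr0.
Qed.

Lemma lift_infty_neq0 x : x != 0 -> lift_infty x != 0.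
Proof. by move=> x0; rewrite -normr_eq0 lift_infty_norm normr_eq0. Qed.

Definition proj_infty (p : proj_space H) : proj_space H1 :=
  proj_pt (lift_infty_neq0 (proj_repr_neq0 p)).

(** Shows that the choice of representative in [proj_infty] does not matter. *)
Lemma proj_infty_pt x (x0 : x != 0) :
  proj_infty (proj_pt x0) = proj_pt (lift_infty_neq0 x0).
Proof.
have [k k0 kx] := proj_repr_pt x0; apply: (@proj_pt_scale _ _ _ _ _ _ k).
by rewrite /lift_infty kx; congr (_, _); rewrite /= -[LHS](mulr0 k).
Qed.

Lemma proj_infty_isometry p q : mdist (proj_infty p) (proj_infty q) = mdist p q.
Proof.
have [u [u1 [u0 ->]]] := proj_pt_unit p; have [v [v1 [v0 ->]]] := proj_pt_unit q.
rewrite !proj_infty_pt !mdist_proj_unit ?lift_infty_norm//.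
congr Num.min; rewrite -[RHS]lift_infty_norm; congr (`|_|); congr (_, _) => /=.
  by rewrite subr0.
by rewrite addr0.
Qed.

End lift.

Section lift_flow.
Context {R : realType} {B : metricType R} {H : fdHilbertType R}.
Variables (theta : R -> B -> B) (phi psi : R -> B -> H -> H) (f : B -> R -> H).
Hypothesis Psi_affine : affine_flow theta phi f psi.
Local Notation phi1 := (lift_cocycle theta phi f).

Let linF : linear_flow theta phi. Proof. by case: Psi_affine. Qed.
Let f_Linfty : forall b, in_Linfty (f b). Proof. by case: Psi_affine. Qed.
Let cF := @forcing_continuous _ _ _ _ _ linF _ _ Psi_affine.

(** The flow law of the lift is the cocycle identity [forcingD] read in the first coordinate, and
    its continuity is that of [phi] and of the forcing term. *)
Lemma lift_linear_flow : linear_flow theta phi1.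
Proof.
have F0 b : forcing theta phi f 0 b = 0.
  have := forcingD linF f_Linfty Psi_affine 0 0 b; rewrite addr0.
  have [[_ id0 _] _] := linF; have [tb _] := id0 (b, 0 : H).
  rewrite tb; have [_ ->] := id0 (b, forcing theta phi f 0 b).
  by move/eqP; rewrite addrC -subr_eq subrr eq_sym => /eqP.
split; last first.
  move=> t b a [x r] [y s]; set F := forcing theta phi f t b.
  change ((phi t b (a *: x + y) + (a * r + s) *: F, a * r + s) =
    (a *: (phi t b x + r *: F) + (phi t b y + s *: F), a * r + s)).
  congr (_, _); rewrite (cocycleD linF) (cocycleZ linF) scalerDr scalerDl scalerA.
  by rewrite addrACA.
split.
- have c22 : continuous (fun z : R * (B * lift_space H) => z.2.2).
    by move=> z; exact: (continuous_comp (@snd_continuous _ _ z) (@snd_continuous _ _ z.2)).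
  have c21 : continuous (fun z : R * (B * lift_space H) => z.2.1).
    by move=> z; exact: (continuous_comp (@snd_continuous _ _ z) (@fst_continuous _ _ z.2)).
  have c1 : continuous (fun z : R * (B * lift_space H) => z.1).
    exact: fst_continuous.
  have c221 : continuous (fun z : R * (B * lift_space H) => z.2.2.1).
    by move=> z; exact: (continuous_comp (c22 z) (@lift_space_fst_continuous _ _ _)).
  have c222 : continuous (fun z : R * (B * lift_space H) => z.2.2.2 : R).
    by move=> z; exact: (continuous_comp (c22 z) (@lift_space_snd_continuous _ _ _)).
  have cs : continuous (fun z : R * (B * lift_space H) =>
      skew_flow theta phi z.1 (z.2.1, z.2.2.1)).
    have h := continuous_pair c1 (continuous_pair c21 c221).
    have [[cF0 _ _] _] := linF.
    by move=> z; exact: (continuous_comp (h z) (cF0 _)).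
  apply: continuous_pair.
    by move=> z; exact: (continuous_comp (cs z) (@fst_continuous _ _ _)).
  have cphi : continuous (fun z : R * (B * lift_space H) => phi z.1 z.2.1 z.2.2.1).
    by move=> z; exact: (continuous_comp (cs z) (@snd_continuous _ _ _)).
  have cforce : continuous
      (fun z : R * (B * lift_space H) => forcing theta phi f z.1 z.2.1).
    by have h := continuous_pair c1 c21 => z; exact: (continuous_comp (h z) (@cF _)).
  apply: lift_space_continuous => // z.
  exact: (continuousD (cphi z) (continuousZ (c222 z) (cforce z))).
- move=> [b [x r]]; rewrite /skew_flow /lift_cocycle /= F0 scaler0 addr0.
  by have [[_ id0 _] _] := linF; have [-> ->] := id0 (b, x).
- move=> t s [b [x r]]; rewrite /skew_flow /lift_cocycle /=.
  congr (_, (_, _)); first exact: (base_flowE linF).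
  rewrite (forcingD linF f_Linfty Psi_affine) (cocycleE linF) scalerDr.
  by rewrite (cocycleD linF) (cocycleZ linF) addrA.
Qed.

Lemma proj_set_bundle_infty (V : set (B * H)) : proj_set (bundle_infty V) =
  (fun z => (z.1, proj_infty z.2)) @` proj_set V.
Proof.
apply/seteqP; split=> -[b p].
  move=> [[[x r] x0]] /= [Vx r0] ->.
  have {}r0 : r = 0 by [].
  have x00 : x != 0.
    by move: x0; rewrite r0; apply: contra_neq => ->.
  exists (b, proj_pt x00); first by exists (exist _ x x00) => //=; exact: val_inj.
  congr (_, _); rewrite /= proj_infty_pt.
  by apply: (@proj_pt_scale _ _ _ _ _ _ 1); rewrite scale1r /lift_infty r0.
move=> [[b' q] [[x x0] /= Vx qx] [<- <-]].
exists (exist _ (lift_infty x) (lift_infty_neq0 x0)) => //=.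
rewrite qx proj_infty_pt; exact: val_inj.
Qed.

Lemma morse_spectrum_infty (V : set (B * H)) :
  morse_spectrum theta phi1 (bundle_infty V) = morse_spectrum theta phi V.
Proof.
have phi1E t b x : phi1 t b (lift_infty x) = lift_infty (phi t b x).
  by rewrite /lift_cocycle /= scale0r addr0.
rewrite !morse_spectrumE proj_set_bundle_infty.
apply: mean_spectrum_embed => [[b p] [b' p']|t [b p]|t [b p]].
- change (Num.max (mdist b b') (mdist (proj_infty p) (proj_infty p')) =
    Num.max (mdist b b') (mdist p p')).
  by rewrite proj_infty_isometry.
- have [x [_ [x0 ->]]] := proj_pt_unit p.
  have px0 := linear_flow_neq0 t b linF x0.
  have p1x0 := linear_flow_neq0 t b lift_linear_flow (lift_infty_neq0 x0).
  rewrite (proj_flowE _ px0 linF).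
  change (proj_flow theta phi1 t (b, proj_infty (proj_pt x0)) =
    (theta t b, proj_infty (proj_pt px0))).
  rewrite !proj_infty_pt (proj_flowE _ p1x0 lift_linear_flow); congr (_, _).
  by apply: (@proj_pt_scale _ _ _ _ _ _ 1); rewrite scale1r phi1E.
- have [x [_ [x0 ->]]] := proj_pt_unit p.
  change (proj_weight phi1 t (b, proj_infty (proj_pt x0)) =
    proj_weight phi t (b, proj_pt x0)).
  rewrite proj_infty_pt (proj_weightE lift_linear_flow) (proj_weightE linF).
  by rewrite phi1E !lift_infty_norm.
Qed.

Let PF1 := proj_flow theta phi1.
Let flow1 : is_flow PF1 := proj_flow_is_flow lift_linear_flow.

Lemma lift_neq0 (x : H) : (x, 1) != 0 :> lift_space H.
Proof. by apply/eqP => -[_ /eqP]; rewrite oner_eq0. Qed.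

Lemma lift_period tau b x : skew_flow theta psi tau (b, x) = (b, x) ->
  skew_flow theta phi1 tau (b, (x, 1)) = (b, (x, 1)).
Proof.
have [_ _ _ psiE _] := Psi_affine => -[bb]; rewrite psiE => xx.
by rewrite /skew_flow /lift_cocycle /= bb scale1r xx.
Qed.

Lemma proj_lift_period tau b x : skew_flow theta psi tau (b, x) = (b, x) ->
  PF1 tau (b, proj_pt (lift_neq0 x)) = (b, proj_pt (lift_neq0 x)).
Proof.
move=> /lift_period h.
have bb : theta tau b = b := congr1 fst h.
have xx : phi1 tau b (x, 1) = (x, 1) := congr1 snd h.
have y0 := linear_flow_neq0 tau b lift_linear_flow (lift_neq0 x).
rewrite /PF1 (proj_flowE _ y0 lift_linear_flow) bb; congr (_, _).
by apply: (@proj_pt_scale _ _ _ _ _ _ 1); rewrite scale1r xx.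
Qed.

Lemma central_bundle_periodic Vc b x :
  central_selgrade_bundle theta phi f Vc ->
  periodic_point (skew_flow theta psi) (b, x) ->
  forall t, Vc (skew_flow theta phi1 t (b, (x, 1))).
Proof.
move=> [_ Vc_unique] [tau tau0 /proj_lift_period].
set z := (b, _) => zz.
pose w (_ : R) (_ : B * proj_space (lift_space H)) : R := 0.
have rz t eps T : 0 < eps -> reach PF1 w setT eps T z (PF1 t z) /\
    reach PF1 w setT eps T (PF1 t z) z.
  by move=> eps0; exact: (periodic_reach w flow1 T tau0 zz).
have [M cM Mz] : exists2 M, chain_component PF1 M & M z.
  apply: (chain_component_exists (w := w)) => eps T eps0 _.
  by have [] := rz tau eps T eps0; rewrite zz.
have Mt t : M (PF1 t z).
  apply: (chain_component_equiv (w := w) cM Mz) => eps T eps0 _;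
  by have [] := rz t eps T eps0.
have VM t : bundle_of M (skew_flow theta phi1 t (b, (x, 1))).
  move=> /= y0; have := Mt t.
  by rewrite /PF1 /z (proj_flowE _ y0 lift_linear_flow).
rewrite (Vc_unique (bundle_of M))//; split; first by exists M.
by exists (skew_flow theta phi1 0 (b, (x, 1))) => //=; exact: oner_neq0.
Qed.

Lemma zero_morse_spectrum Vc b x :
  central_selgrade_bundle theta phi f Vc ->
  periodic_point (skew_flow theta psi) (b, x) ->
  morse_spectrum theta phi1 Vc 0.
Proof.
move=> cVc per; have Vt := central_bundle_periodic cVc per.
have [[[M cM VcM] _] _] := cVc.
have [tau tau0 pert] := per.
have [[_ id0 _] _] := lift_linear_flow.
have Mz : M (b, proj_pt (lift_neq0 x)).
  by have := Vt 0; rewrite id0 VcM; exact.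
rewrite morse_spectrumE VcM proj_set_bundle_of => eps T e eps0 T0 e0.
have [n Tn] := large_period T tau0; pose z := (b, proj_pt (lift_neq0 x)).
exists z, z, (tau *+ n), (proj_weight phi1 (tau *+ n) z); split.
  have zz : PF1 (tau *+ n) z = z := flow_period n flow1 (proj_lift_period pert).
  by apply: wchain1; rewrite // -/PF1 zz mdistxx.
rewrite (proj_weightE lift_linear_flow).
have h := flow_period n lift_linear_flow.1 (lift_period pert).
have -> : phi1 (tau *+ n) b (x, 1) = (x, 1) := congr1 snd h.
by rewrite subrr mulr0 subrr normr0.
Qed.

Lemma morse_spectrum_convex V : compact [set: B] ->
  selgrade_bundle theta phi1 V ->
  @convex_set R R^o (morse_spectrum theta phi1 V).
Proof.
move=> cB [M cM ->].
rewrite morse_spectrumE proj_set_bundle_of.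
apply: (mean_spectrum_convex flow1) => //.
by rewrite -setXTT; apply: compact_setX => //; exact: compact_proj_space.
Qed.

End lift_flow.

Lemma morse_spectrum_sub (R : realType) (B : metricType R) (H : fdHilbertType R)
    (theta : R -> B -> B) (phi : R -> B -> H -> H) (V W : set (B * H)) :
  V `<=` W -> morse_spectrum theta phi V `<=` morse_spectrum theta phi W.
Proof.
move=> VW lambda [eps [T [z [? ? hz ?]]]]; exists eps, T, z; split=> // k.
have [? ? ? Vz] := hz k; split=> // i /Vz[x Vx px].
by exists x => //; exact: VW.
Qed.

Theorem theorem16 (R : realType) (B : metricType R) (H : fdHilbertType R)
    (theta : R -> B -> B) (phi psi : R -> B -> H -> H) (f : B -> R -> H)
    (B_compact : compact [set: B])
    (theta_flow : is_flow theta)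
    (theta_transitive : chain_transitive theta [set: B])
    (Psi_affine : affine_flow theta phi f psi)
    (l : nat) (M : 'I_l -> set (B * proj_space H))
    (M_numbering : component_numbering theta phi M)
    (Vc : set (B * lift_space H))
    (Vc_central : central_selgrade_bundle theta phi f Vc)
    (lplus lzero : nat)
    (block : forall i : 'I_l,
      bundle_infty (bundle_of (M i)) `<=` Vc <->
      (lplus.+1 <= i.+1 <= lplus + lzero)%N) :
  let V := fun i : 'I_l => bundle_of (M i) in
  let phi1 := lift_cocycle theta phi f in
  let Psi := skew_flow theta psi in
  let Psi1 := skew_flow theta phi1 in
  let J := [set i : 'I_l | (lplus.+1 <= i.+1 <= lplus + lzero)%N] in
  [/\ forall i : 'I_l, J i ->
        morse_spectrum theta phi (V i) `<=` morse_spectrum theta phi1 Vc,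
      (exists y : B * H, periodic_point Psi y) ->
        (forall (b : B) (x : H), periodic_point Psi (b, x) ->
          unique (fun W : set (B * lift_space H) =>
            selgrade_bundle theta phi1 W /\
            forall t : R, W (Psi1 t (b, (x, 1)))) Vc) /\
        convex_hull ([set 0] `|` \bigcup_(i in J) morse_spectrum theta phi (V i))
          `<=` morse_spectrum theta phi1 Vc
    & forall i : 'I_l,
        morse_spectrum theta phi1 (bundle_infty (V i)) =
        morse_spectrum theta phi (V i)].
Proof.
move=> V phi1 Psi Psi1 J.
have inVc i : J i ->
    morse_spectrum theta phi (V i) `<=` morse_spectrum theta phi1 Vc.
  move=> Ji; rewrite -(morse_spectrum_infty Psi_affine).
  exact/morse_spectrum_sub/block.
have [[Vc_selgrade _] Vc_unique] := Vc_central.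
split=> //; last by move=> i; exact: morse_spectrum_infty Psi_affine _.
move=> [[b0 x0] per0]; split.
  move=> b x per; split; first by split=> //; exact: central_bundle_periodic per.
  move=> W [selW hW]; apply: Vc_unique; split=> //.
  by exists (Psi1 0 (b, (x, 1))); [exact: hW|exact: oner_neq0].
apply: smallest_sub; first exact: (morse_spectrum_convex Psi_affine B_compact).
move=> lambda [->|[i Ji]]; last exact: inVc.
exact: zero_morse_spectrum per0.
Qed.
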